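(* Let $R$ be a commutative Noetherian ring, $M$ a finitely generated $R$-module, and $C$ a semidualizing $R$-module. Assume $t^{C}(M)<\infty$. Then the following are equivalent. (1) For every integer $i$, $M$ is $i$-$C$-torsionfree if and only if $M$ satisfies $\widetilde{S}^{C}_{i}$. (2) There exists an associated prime $p$ of $\operatorname{Ext}_{R}^{t^{C}(M)+1}(\operatorname{Tr}_{C}M,C)$ such that $t^{C}(M)+1\le \operatorname{depth} C_{p}$.
   Context: A finitely generated $R$-module $C$ is semidualizing if the homothety map $R\to\operatorname{Hom}_R(C,C)$ is an isomorphism and $\operatorname{Ext}^i_R(C,C)=0$ for all $i\ge 1$. For a presentation $P_1\xrightarrow{d_1}P_0\to M\to 0$ of $M$ by finitely generated projective $R$-modules, $\operatorname{Tr}_C M$ denotes the cokernel of $\operatorname{Hom}_R(d_1,C)\colon \operatorname{Hom}_R(P_0,C)\to\operatorname{Hom}_R(P_1,C)$; the modules $\operatorname{Ext}^i_R(\operatorname{Tr}_CM,C)$ with $i\ge1$ do not depend, up to isomorphism, on the chosen presentation. For an integer $n$, $M$ is called $n$-$C$-torsionfree if $\operatorname{Ext}_R^{j}(\operatorname{Tr}_CM,C)=0$ for all $1\le j\le n$ (a vacuous condition if $n\le 0$). $t^{C}(M)$ is the supremum of the integers $n$ such that $M$ is $n$-$C$-torsionfree. For an integer $i$, $M$ satisfies $\widetilde{S}^{C}_{i}$ if $\operatorname{depth} M_p\ge\inf\{i,\operatorname{depth} C_p\}$ for all $p\in\operatorname{Spec}R$. Here depth is taken over the local ring $R_p$, and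 the depth of the zero module is $\infty$. *)

(* Defs.v *)
From HB Require Import structures.
From mathcomp Require Import all_boot all_order all_algebra.
From mathcomp Require Import generic_quotient ring_quotient.
From mathcomp Require Import boolp classical_sets functions constructive_ereal.
From mathcomp Require Import freeg.
From mathcomp Require Import ring zify.

Set Implicit Arguments.
Unset Strict Implicit.
Unset Printing Implicit Defensive.

Import Order.TTheory GRing.Theory Num.Theory.
Import Quotient.Exports.

Local Open Scope classical_set_scope.
Local Open Scope quotient_scope.
Local Open Scope ring_scope.

Section LinearLmodule.
Variables (R : comNzRingType) (U V : lmodType R).
Implicit Types f g h : {linear U -> V}.

Lemma linear_ext f g : f =1 g -> f = g.
Proof.
case: f g => [f fP] [g gP] /= /funext fg; case: _ / fg in gP *.
by congr GRing.Linear.Pack; case: fP gP => [[?] [?]] [[?] [?]];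
   congr GRing.Linear.Class; congr (_ _); exact: Prop_irrelevance.
Qed.

HB.instance Definition _ := gen_eqMixin {linear U -> V}.
HB.instance Definition _ := gen_choiceMixin {linear U -> V}.

Definition lin_zero : {linear U -> V} := \0.
Definition lin_opp f : {linear U -> V} := \- f.
Definition lin_add f g : {linear U -> V} := f \+ g.
Definition lin_scale (a : R) f : {linear U -> V} := a \*: f.

Lemma lin_addA : associative lin_add.
Proof. by move=> f g h; apply: linear_ext => x /=; rewrite addrA. Qed.
Lemma lin_addC : commutative lin_add.
Proof. by move=> f g; apply: linear_ext => x /=; rewrite addrC. Qed.
Lemma lin_add0 : left_id lin_zero lin_add.
Proof. by move=> f; apply: linear_ext => x /=; rewrite add0r. Qed.
Lemma lin_addN : left_inverse lin_zero lin_opp lin_add.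
Proof. by move=> f; apply: linear_ext => x /=; rewrite addNr. Qed.
HB.instance Definition _ :=
  GRing.isZmodule.Build {linear U -> V} lin_addA lin_addC lin_add0 lin_addN.

Lemma lin_scaleA a b f : lin_scale a (lin_scale b f) = lin_scale (a * b) f.
Proof. by apply: linear_ext => x /=; rewrite scalerA. Qed.
Lemma lin_scale1 : left_id 1 lin_scale.
Proof. by move=> f; apply: linear_ext => x /=; rewrite scale1r. Qed.
Lemma lin_scaleDr : right_distributive lin_scale +%R.
Proof. by move=> a f g; apply: linear_ext => x /=; rewrite scalerDr. Qed.
Lemma lin_scaleDl f : {morph lin_scale^~ f : a b / a + b}.
Proof. by move=> a b; apply: linear_ext => x /=; rewrite scalerDl. Qed.
HB.instance Definition _ := GRing.Zmodule_isLmodule.Build R {linear U -> V}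
  lin_scaleA lin_scale1 lin_scaleDr lin_scaleDl.
End LinearLmodule.

Section Precomposition.
Variables (R : comNzRingType) (U U' V : lmodType R) (d : {linear U -> U'}).

(* Hom_R(d, V) : Hom_R(U', V) -> Hom_R(U, V) *)
Definition hom_pre (f : {linear U' -> V}) : {linear U -> V} := f \o d.

Lemma hom_pre_is_linear : linear hom_pre.
Proof. by move=> a f g; apply: linear_ext. Qed.
HB.instance Definition _ := GRing.isLinear.Build R
  {linear U' -> V} {linear U -> V} _ hom_pre hom_pre_is_linear.
End Precomposition.

Arguments hom_pre {R U U'} V d f.

Section Submodules.
Variables (R : comNzRingType).

Structure submod (V : lmodType R) := Submod {
  submod_pred :> {pred V};
  submod_closedP : submod_closed submod_pred
}.

Section SubQuotient.
Variables (V : lmodType R) (S : submod V).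

Lemma submod_subsemimod_closed : subsemimod_closed (submod_pred S).
Proof.
have [S0 SZD] := submod_closedP S; split; first split=> //.
  by move=> x y Sx Sy; rewrite -[x]scale1r SZD.
by move=> a x Sx; rewrite -[_ *: _]addr0 SZD.
Qed.
HB.instance Definition _ :=
  GRing.isSubmodClosed.Build R V (submod_pred S) submod_subsemimod_closed.

Record submodule := Submodule {
  submod_val :> V;
  _ : submod_val \in submod_pred S
}.
HB.instance Definition _ := [isSub for submod_val].
HB.instance Definition _ := [Choice of submodule by <:].
HB.instance Definition _ := [SubChoice_isSubLmodule of submodule by <:].

Definition quotmod := Quotient.quot (submod_pred S).
HB.instance Definition _ := GRing.Zmodule.on quotmod.

Definition quotmod_pi (x : V) : quotmod := \pi x.

Lemma quotmod_piP x y : (quotmod_pi x == quotmod_pi y) = (x - y \in submod_pred S).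
Proof. by rewrite Quotient.idealrBE. Qed.

Lemma quotmod_piK (x : quotmod) : quotmod_pi (repr x) = x.
Proof. exact: reprK. Qed.

Lemma quotmod_piD x y : quotmod_pi (x + y) = quotmod_pi x + quotmod_pi y.
Proof. by rewrite /quotmod_pi raddfD. Qed.

Definition quotmod_scale (a : R) (x : quotmod) := quotmod_pi (a *: repr x).

Lemma quotmod_scale_pi a x : quotmod_scale a (quotmod_pi x) = quotmod_pi (a *: x).
Proof.
apply/eqP; rewrite quotmod_piP -scalerBr rpredZ // -quotmod_piP.
by rewrite quotmod_piK.
Qed.

Lemma quotmod_scaleA a b x :
  quotmod_scale a (quotmod_scale b x) = quotmod_scale (a * b) x.
Proof. by rewrite -[x]quotmod_piK !quotmod_scale_pi scalerA. Qed.
Lemma quotmod_scale1 : left_id 1 quotmod_scale.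
Proof. by move=> x; rewrite -[x]quotmod_piK quotmod_scale_pi scale1r. Qed.
Lemma quotmod_scaleDr : right_distributive quotmod_scale +%R.
Proof.
move=> a x y; rewrite -[x]quotmod_piK -[y]quotmod_piK -quotmod_piD.
by rewrite !quotmod_scale_pi scalerDr quotmod_piD.
Qed.
Lemma quotmod_scaleDl x : {morph quotmod_scale^~ x : a b / a + b}.
Proof.
move=> a b; rewrite -[x]quotmod_piK !quotmod_scale_pi.
by rewrite scalerDl quotmod_piD.
Qed.
HB.instance Definition _ := GRing.Zmodule_isLmodule.Build R quotmod
  quotmod_scaleA quotmod_scale1 quotmod_scaleDr quotmod_scaleDl.

Lemma quotmod_pi_is_linear : linear quotmod_pi.
Proof. by move=> a x y; rewrite quotmod_piD -quotmod_scale_pi. Qed.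
HB.instance Definition _ :=
  GRing.isLinear.Build R V quotmod _ quotmod_pi quotmod_pi_is_linear.
End SubQuotient.

Section SubmodConstructions.
Variables (U V : lmodType R).

Lemma submod0_closed : submod_closed (pred1 (0 : V)).
Proof.
split=> [|a x y]; rewrite !inE // => /eqP-> /eqP->.
by rewrite scaler0 addr0.
Qed.
Definition submod0 := Submod submod0_closed.

Lemma lkernel_closed (f : {linear U -> V}) :
  submod_closed [pred x | f x == 0].
Proof.
split=> [|a x y]; rewrite !inE ?raddf0 // => /eqP fx /eqP fy.
by rewrite linearP fx fy scaler0 addr0.
Qed.
Definition lkernel (f : {linear U -> V}) := Submod (lkernel_closed f).

Lemma limage_closed (f : {linear U -> V}) :
  submod_closed [pred y | `[< exists x, f x = y >]].
Proof.
split=> [|a y z]; rewrite !inE.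
  by exists 0; rewrite raddf0.
move=> [x <-] [t <-].
by exists (a *: x + t); rewrite linearP.
Qed.
Definition limage (f : {linear U -> V}) := Submod (limage_closed f).

Lemma lpreimage_closed (f : {linear U -> V}) (S : submod V) :
  submod_closed [pred x | f x \in submod_pred S].
Proof.
have [S0 SZD] := submod_closedP S.
by split=> [|a x y]; rewrite !inE ?raddf0 // linearP; exact: SZD.
Qed.
Definition lpreimage (f : {linear U -> V}) (S : submod V) :=
  Submod (lpreimage_closed f S).
End SubmodConstructions.

Definition coker (U V : lmodType R) (f : {linear U -> V}) : lmodType R :=
  quotmod (limage f).

(* Z / B for submodules B <= Z of V; in general this is Z / (Z :&: B). *)
Definition subquot (V : lmodType R) (Z B : submod V) : lmodType R :=
  quotmod (lpreimage (\val : {linear submodule Z -> V}) B).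

Definition is_zero (V : lmodType R) : Prop := forall x : V, x = 0.

Definition finitely_generated (V : lmodType R) : Prop :=
  exists (n : nat) (g : 'I_n -> V),
    forall x, exists c : 'I_n -> R, x = \sum_(i < n) c i *: g i.

Definition projective (P : lmodType R) : Prop :=
  forall (A B : lmodType R) (g : {linear A -> B}) (f : {linear P -> B}),
    (forall b, exists a, g a = b) ->
    exists h : {linear P -> A}, forall x, g (h x) = f x.
End Submodules.

(* The submodules of the regular module R^o are the ideals of R. *)
Definition noetherian (R : comNzRingType) : Prop :=
  forall I : submod R^o, finitely_generated (submodule I).

Section Ext.
Variable R : comNzRingType.

Record resolution (M : lmodType R) := Resolution {
  res_obj : nat -> lmodType R;
  res_d : forall n, {linear res_obj n.+1 -> res_obj n};
  res_aug : {linear res_obj 0 -> M};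
  res_projective : forall n, projective (res_obj n);
  res_aug_surj : forall x, exists y, res_aug y = x;
  res_exact0 : forall x, res_aug x = 0 <-> exists y, res_d 0 y = x;
  res_exact : forall n x, res_d n x = 0 <-> exists y, res_d n.+1 y = x
}.

Section ExtOf.
Variables (M : lmodType R) (P : resolution M) (N : lmodType R).

Definition cocycles (i : nat) : submod {linear res_obj P i -> N} :=
  lkernel (hom_pre N (res_d P i)).

Definition coboundaries (i : nat) : submod {linear res_obj P i -> N} :=
  match i with
  | 0 => submod0 _
  | j.+1 => limage (hom_pre N (res_d P j))
  end.

Definition Ext_of (i : nat) : lmodType R :=
  subquot (cocycles i) (coboundaries i).
End ExtOf.

(* The canonical free resolution of M: every syzygy is covered by the free
   module {freeg _ / R} on all of its elements. *)
Section StdResolution.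

Definition free_cover (V : lmodType R) (x : {freeg V / R}) : V := fglift id x.

Lemma free_coverU (V : lmodType R) (a : R) (v : V) :
  free_cover << a *g v >> = a *: v.
Proof. exact: liftU. Qed.

Lemma fglift_is_linear (K : choiceType) (V : lmodType R) (f : K -> V) :
  linear (fglift f : {freeg K / R} -> V).
Proof.
have fgB : {morph fglift f : x y / x - y} by exact: lift_is_additive.
have fg0 : fglift f 0 = 0 by rewrite -(subrr 0) fgB subrr.
have fgD : {morph fglift f : x y / x + y}.
  by move=> x y; rewrite -[in LHS](opprK y) -[- y]add0r !fgB fg0 sub0r opprK.
have fgsum (r : seq K) (F : K -> {freeg K / R}) :
  fglift f (\sum_(k <- r) F k) = \sum_(k <- r) fglift f (F k).
  by apply: (big_morph (fglift f)).
move=> a x y; rewrite fgD; congr (_ + _).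
rewrite -[in RHS](freeg_sumE x) fgsum scaler_sumr [LHS]fgsum.
by apply: eq_bigr => k _; rewrite !liftU scalerA.
Qed.
HB.instance Definition _ (V : lmodType R) :=
  GRing.isLinear.Build R {freeg V / R} V _ (@free_cover V)
    (fglift_is_linear (@id V)).

Lemma free_cover_surj (V : lmodType R) (v : V) : exists x, free_cover x = v.
Proof. by exists << 1 *g v >>; rewrite free_coverU scale1r. Qed.

Lemma freeg_projective (K : choiceType) : projective {freeg K / R}.
Proof.
move=> A B g f g_surj.
have [h hP] := choice (fun k : K => g_surj (f << 1 *g k >>)).
pose h' := HB.pack_for {linear {freeg K / R} -> A} (fglift h)
  (GRing.isLinear.Build R {freeg K / R} A _ (fglift h) (fglift_is_linear h)).
exists h' => x; rewrite -(freeg_sumE x) !linear_sum; apply: eq_bigr => k _.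
have -> : << coeff k x *g k >> = coeff k x *: << 1 *g k >>.
  by apply/eqP/freeg_eqP => l; rewrite coeffZ !coeffU mul1r.
rewrite !linearZ /=; congr (_ *: _).
by rewrite liftU scale1r hP.
Qed.

Variable M : lmodType R.

Fixpoint syzygy (n : nat) : lmodType R :=
  match n with
  | 0 => M
  | m.+1 => submodule (lkernel (@free_cover (syzygy m)))
  end.

Definition std_obj (n : nat) : lmodType R := {freeg (syzygy n) / R}.

Definition std_d (n : nat) : {linear std_obj n.+1 -> std_obj n} :=
  (\val : {linear submodule (lkernel (@free_cover (syzygy n))) -> _})
    \o @free_cover (syzygy n.+1).

Lemma std_d_exact n (x : std_obj n) :
  free_cover x = 0 <-> exists y, std_d n y = x.
Proof.
split=> [x0|[y <-]]; last first.
  exact/eqP/(valP (free_cover y : submodule (lkernel (@free_cover _)))).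
have kx : x \in lkernel (@free_cover (syzygy n)) by exact/eqP.
have [y yP] := free_cover_surj (Submodule kx : syzygy n.+1).
by exists y; rewrite /std_d /= yP.
Qed.

Lemma std_exact n (x : std_obj n.+1) :
  std_d n x = 0 <-> exists y, std_d n.+1 y = x.
Proof.
rewrite -std_d_exact; split=> [dx0|xP]; last by rewrite /std_d /= xP.
exact/val_inj.
Qed.

Definition std_resolution : resolution M :=
  @Resolution M std_obj std_d (@free_cover M)
    (fun n => @freeg_projective (syzygy n)) (@free_cover_surj M)
    (@std_d_exact 0) std_exact.
End StdResolution.

Definition Ext (i : nat) (M N : lmodType R) : lmodType R :=
  Ext_of (std_resolution M) N i.
End Ext.

Section Localization.
Variables (R : comNzRingType) (p : prime_idealr R).

Record denominator := Denominator {
  den : R;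
  _ : den \notin (p : {pred R})
}.
HB.instance Definition _ := [isSub for den].
HB.instance Definition _ := [Choice of denominator by <:].

Lemma den1_subproof : 1 \notin (p : {pred R}).
Proof. by rewrite idealr1. Qed.
Definition den1 := Denominator den1_subproof.

Lemma denM_subproof (s t : denominator) : den s * den t \notin (p : {pred R}).
Proof. by rewrite prime_idealrM negb_or (valP s) (valP t). Qed.
Definition denM s t := Denominator (denM_subproof s t).

Section Fractions.
Variable M : lmodType R.

(* m / s = n / t iff w t m = w s n for some w outside p *)
Definition frac_eq (x y : M * denominator) : bool :=
  `[< exists w : denominator,
        (den w * den y.2) *: x.1 = (den w * den x.2) *: y.1 >].

Lemma frac_eq_is_equiv : equiv_class_of frac_eq.
Proof.
have sym x y : frac_eq x y -> frac_eq y x.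
  by move=> /asboolP[w e]; apply/asboolP; exists w.
split=> [x|x y|y x z].
- by apply/asboolP; exists den1.
- by apply/idP/idP; apply: sym.
- move=> /asboolP[w e] /asboolP[w' e']; apply/asboolP.
  exists (denM (denM w w') y.2) => /=.
  transitivity ((den w' * den z.2) *: ((den w * den y.2) *: x.1)).
    by rewrite scalerA; congr (_ *: _); ring.
  rewrite e; transitivity ((den w * den x.2) *: ((den w' * den z.2) *: y.1)).
    by rewrite !scalerA; congr (_ *: _); ring.
  by rewrite e' scalerA; congr (_ *: _); ring.
Qed.
Canonical frac_equiv := EquivRelPack frac_eq_is_equiv.
Canonical frac_encModRel := defaultEncModRel frac_eq.

Definition localization := {eq_quot frac_eq}.
HB.instance Definition _ := Choice.on localization.

Definition frac (m : M) (s : denominator) : localization := \pi_localization (m, s).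

Lemma frac_eqP m s n t :
  frac m s = frac n t <->
  exists w : denominator, (den w * den t) *: m = (den w * den s) *: n.
Proof.
rewrite /frac; split=> [/eqquotP/asboolP//|e].
by apply/eqquotP/asboolP.
Qed.

Lemma fracK (x : localization) : frac (repr x).1 (repr x).2 = x.
Proof. by rewrite /frac -surjective_pairing reprK. Qed.

Lemma frac_ind (P : localization -> Prop) :
  (forall m s, P (frac m s)) -> forall x, P x.
Proof. by move=> Pf x; rewrite -(fracK x). Qed.

Lemma repr_frac m s : exists w : denominator,
  (den w * den s) *: (repr (frac m s)).1 =
  (den w * den (repr (frac m s)).2) *: m.
Proof. by apply/frac_eqP; rewrite fracK. Qed.

Definition loc_zero : localization := frac 0 den1.
Definition loc_opp (x : localization) := frac (- (repr x).1) (repr x).2.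
Definition loc_add (x y : localization) :=
  frac (den (repr y).2 *: (repr x).1 + den (repr x).2 *: (repr y).1 : M)
       (denM (repr x).2 (repr y).2).

Lemma loc_opp_frac m s : loc_opp (frac m s) = frac (- m) s.
Proof.
have [w e] := repr_frac m s.
by apply/frac_eqP; exists w; rewrite !scalerN e.
Qed.

Lemma loc_add_frac m s n t :
  loc_add (frac m s) (frac n t) = frac (den t *: m + den s *: n) (denM s t).
Proof.
have [w e] := repr_frac m s; have [w' e'] := repr_frac n t.
apply/frac_eqP; exists (denM w w') => /=.
set x := repr (frac m s) in e *; set y := repr (frac n t) in e' *.
rewrite !scalerDr !scalerA; congr (_ + _).
  transitivity ((den w' * den t * den y.2) *: ((den w * den s) *: x.1)).
    by rewrite scalerA; congr (_ *: _); ring.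
  by rewrite e scalerA; congr (_ *: _); ring.
transitivity ((den w * den s * den x.2) *: ((den w' * den t) *: y.1)).
  by rewrite scalerA; congr (_ *: _); ring.
by rewrite e' scalerA; congr (_ *: _); ring.
Qed.

Lemma loc_addA : associative loc_add.
Proof.
elim/frac_ind=> m s; elim/frac_ind=> n t; elim/frac_ind=> k u.
rewrite !loc_add_frac; apply/frac_eqP; exists den1.
rewrite /= !scalerDr !scalerA !addrA.
by congr (_ *: _ + _ *: _ + _ *: _); ring.
Qed.
Lemma loc_addC : commutative loc_add.
Proof.
elim/frac_ind=> m s; elim/frac_ind=> n t.
rewrite !loc_add_frac; apply/frac_eqP; exists den1.
rewrite /= addrC !scalerDr !scalerA.
by congr (_ *: _ + _ *: _); ring.
Qed.
Lemma loc_add0 : left_id loc_zero loc_add.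
Proof.
elim/frac_ind=> m s; rewrite loc_add_frac; apply/frac_eqP; exists den1.
by rewrite /= scaler0 add0r scale1r !mul1r.
Qed.
Lemma loc_addN : left_inverse loc_zero loc_opp loc_add.
Proof.
elim/frac_ind=> m s; rewrite loc_opp_frac loc_add_frac.
apply/frac_eqP; exists den1.
by rewrite /= scalerN addNr !scaler0.
Qed.
HB.instance Definition _ :=
  GRing.isZmodule.Build localization loc_addA loc_addC loc_add0 loc_addN.
End Fractions.

Definition loc_ring := localization R^o.
HB.instance Definition _ := GRing.Zmodule.on loc_ring.

Section Scale.
Variable M : lmodType R.

Definition loc_scale (a : loc_ring) (x : localization M) : localization M :=
  frac ((repr a).1 *: (repr x).1) (denM (repr a).2 (repr x).2).

Lemma loc_scale_frac (r : R^o) s (m : M) t :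
  loc_scale (frac r s) (frac m t) = frac (r *: m) (denM s t).
Proof.
have [w e] := repr_frac r s; have [w' e'] := repr_frac m t.
apply/frac_eqP; exists (denM w w') => /=.
set a := repr (frac r s) in e *; set x := repr (frac m t) in e' *.
have {}e : den w * den s * a.1 = den w * den a.2 * r by [].
transitivity ((den w * den s * a.1) *: ((den w' * den t) *: x.1)).
  by rewrite !scalerA; congr (_ *: _); ring.
by rewrite e e' !scalerA; congr (_ *: _); ring.
Qed.
End Scale.

Definition loc_one : loc_ring := frac (1 : R^o) den1.
Definition loc_mul (a b : loc_ring) : loc_ring := loc_scale a b.

Lemma loc_mul_frac (a b : R) s t :
  loc_mul (frac (a : R^o) s) (frac (b : R^o) t) = frac (a * b : R^o) (denM s t).
Proof. exact: loc_scale_frac. Qed.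

Lemma loc_scaleA M a b (x : localization M) :
  loc_scale a (loc_scale b x) = loc_scale (loc_mul a b) x.
Proof.
elim/frac_ind: a => a s; elim/frac_ind: b => b t; elim/frac_ind: x => m u.
rewrite loc_mul_frac (loc_scale_frac b t) !loc_scale_frac; apply/frac_eqP; exists den1 => /=.
by rewrite !scalerA; congr (_ *: _); ring.
Qed.
Lemma loc_scale1 M : left_id loc_one (@loc_scale M).
Proof.
elim/frac_ind=> m s; rewrite loc_scale_frac; apply/frac_eqP; exists den1 => /=.
by rewrite scale1r !mul1r.
Qed.
Lemma loc_scaleDr M : right_distributive (@loc_scale M) +%R.
Proof.
elim/frac_ind=> a s; elim/frac_ind=> m t; elim/frac_ind=> n u.
rewrite [_ + _]loc_add_frac !loc_scale_frac [RHS]loc_add_frac.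
apply/frac_eqP; exists den1 => /=.
rewrite !scalerDr !scalerA.
by congr (_ *: _ + _ *: _); ring.
Qed.
Lemma loc_scaleDl M (x : localization M) : {morph (@loc_scale M)^~ x : a b / a + b}.
Proof.
elim/frac_ind: x => m u; elim/frac_ind=> a s; elim/frac_ind=> b t.
rewrite [_ + _]loc_add_frac !loc_scale_frac [RHS]loc_add_frac.
apply/frac_eqP; exists den1 => /=.
rewrite !scalerDr !scalerA -scalerDl.
have E (c d : R) : c *: (d : R^o) = c * d by [].
by congr (_ *: _); rewrite !E; ring.
Qed.
Lemma loc_mulC : commutative loc_mul.
Proof.
elim/frac_ind=> a s; elim/frac_ind=> b t.
rewrite !loc_mul_frac mulrC; apply/frac_eqP; exists den1 => /=.
by rewrite [den t * den s]mulrC.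
Qed.
Lemma loc_one_neq0 : loc_one != 0.
Proof.
apply/eqP => /frac_eqP[w]; rewrite /GRing.scale /= !mulr0 !mulr1 => w0.
by have := valP w; rewrite /= w0 rpred0.
Qed.
HB.instance Definition _ := GRing.Zmodule_isComNzRing.Build loc_ring
  (@loc_scaleA R^o) loc_mulC (@loc_scale1 R^o)
  (fun a b c => @loc_scaleDl R^o c a b) loc_one_neq0.

HB.instance Definition _ (M : lmodType R) :=
  GRing.Zmodule_isLmodule.Build loc_ring (localization M)
    (@loc_scaleA M) (@loc_scale1 M) (@loc_scaleDr M) (@loc_scaleDl M).

(* p R_p *)
Definition loc_max : set loc_ring :=
  [set x | exists (a : R) (s : denominator),
     a \in (p : {pred R}) /\ x = frac (a : R^o) s].
End Localization.

Definition int_sup (A : set int) : \bar int := supremum -oo%E (EFin @` A).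

(* int_sup never falls back on a default value when A is nonempty *)
Lemma int_supP (A : set int) : A !=set0 ->
  supremums (EFin @` A : set (\bar int)) (int_sup A).
Proof.
move=> [a Aa]; rewrite /int_sup /supremum ifF; last first.
  by apply/negP => /eqP A0; have : (EFin @` A) a%:E by [exists a]; rewrite A0.
apply: xgetPex; have [[b bP]|Aoo] := pselect (exists b, forall n, A n -> n <= b).
  pose Q k := `[< exists n, A n /\ absz (b - n) = k >].
  have exQ : exists k, Q k by exists (absz (b - a)); apply/asboolP; exists a.
  case: (ex_minnP exQ) => k /asboolP[n [An nk]] kmin.
  exists n%:E; split=> [_ [m Am <-]|u]; last by apply; exists n.
  have : (k <= absz (b - m))%N by apply: kmin; apply/asboolP; exists m.
  have := bP m Am; have := bP n An; rewrite lee_fin; lia.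
exists +oo%E; split=> [x _|u uP]; first exact: leey.
case: u uP => [r rP||] //; last by move=> /(_ a%:E); apply; exists a.
by case: Aoo; exists r => n An; rewrite -lee_fin; apply: rP; exists n.
Qed.

Section Depth.
Variables (S : comNzRingType) (N : lmodType S).

(* (x_1, ..., x_k) N, for s = [:: x_1; ...; x_k] *)
Definition seq_mul (s : seq S) : set N :=
  [set n | exists c : 'I_(size s) -> N, n = \sum_(i < size s) s`_i *: c i].

(* x_(i+1) is a nonzerodivisor on N / (x_1, ..., x_i) N for all i, and
   N / (x_1, ..., x_k) N != 0. *)
Definition regular_seq (s : seq S) : Prop :=
  (forall i : nat, (i < size s)%N -> forall n : N,
     seq_mul (take i s) (s`_i *: n) -> seq_mul (take i s) n) /\
  exists n : N, ~ seq_mul s n.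

(* For S local with maximal ideal I this is the depth of N. *)
Definition depth (I : set S) : \bar int :=
  if `[< is_zero N >] then +oo%E
  else int_sup [set (size s)%:Z | s in [set s : seq S |
      (forall x, x \in s -> I x) /\ regular_seq s]].
End Depth.

Definition depth_at (R : comNzRingType) (p : prime_idealr R) (M : lmodType R) :
  \bar int := depth (localization p M) (@loc_max R p).

Section Torsionfree.
Variable R : comNzRingType.

Definition homothety (C : lmodType R) (r : R) : {linear C -> C} :=
  r \*: (idfun : {linear C -> C}).

Definition semidualizing (C : lmodType R) : Prop :=
  [/\ finitely_generated C,
      bijective (homothety C) &
      forall i : nat, (1 <= i)%N -> is_zero (Ext i C C)].

Definition is_associated (p : prime_idealr R) (E : lmodType R) : Prop :=
  exists x : E, forall a : R, (a \in (p : {pred R})) = (a *: x == 0).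

Definition fg_proj_presentation (M P0 P1 : lmodType R)
    (d1 : {linear P1 -> P0}) (d0 : {linear P0 -> M}) : Prop :=
  [/\ finitely_generated P0 /\ projective P0,
      finitely_generated P1 /\ projective P1,
      forall m, exists x, d0 x = m &
      forall x, d0 x = 0 <-> exists y, d1 y = x].

Section TrC.
(* P1 -> P0 -> M -> 0 is a presentation of M; the notions below are attached
   to M through it. *)
Variables (C P0 P1 : lmodType R) (d1 : {linear P1 -> P0}).

Definition Tr : lmodType R := coker (hom_pre C d1).

Definition torsionfree (n : int) : Prop :=
  forall j : nat, (1 <= j)%N -> j%:Z <= n -> is_zero (Ext j Tr C).

Definition torsionfree_index : \bar int :=
  int_sup torsionfree.

Lemma torsionfree_index_ge0 : (0 <= torsionfree_index)%E.
Proof.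
have tf0 : torsionfree 0 by move=> j j1; rewrite lez_nat leqn0; case: j j1.
by have [ub _] := int_supP (ex_intro _ 0 tf0); apply: ub; exists 0.
Qed.
End TrC.

Definition Stilde (C M : lmodType R) (i : int) : Prop :=
  forall p : prime_idealr R,
    (Order.min i%:E (depth_at p C) <= depth_at p M)%E.
End Torsionfree.

(* Main.v *)
From HB Require Import structures.
From mathcomp Require Import freeg.
From mathcomp Require Import all_boot all_order all_algebra.
From mathcomp Require Import boolp classical_sets constructive_ereal.
From mathcomp Require Import ring zify.
Require Import Defs.

Set Implicit Arguments.
Unset Strict Implicit.
Unset Printing Implicit Defensive.

Import Order.TTheory GRing.Theory Num.Theory.

Local Open Scope classical_set_scope.
Local Open Scope ring_scope.

(* Write (-)^+ for Hom(-, C) and T = Tr M = coker(P0^+ -> P1^+).  Prolonging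
   P0^+ -> P1^+ -> T by a resolution of the kernel by finitely generated
   projective modules F_i gives a resolution of T by Hom(-, C)-acyclic modules;
   since P = P^++ for P finitely generated projective, its dual shows that
   Ext^(j+1)(T, C) is the cohomology in degree j of a complex
       0 -> M -> F_0^+ -> F_1^+ -> ...
   whose terms in positive degree are direct summands of finite sums of copies
   of C.  Let t = t^C(M), so that this complex is exact in degrees < t.
   Localize at p and let k be the residue field: splitting the complex into
   short exact sequences gives depth M_p >= min(t, depth C_p), and when
   depth C_p > t it shows that Ext^t(k, M_p) = Hom(k, H) for the localized
   cohomology H in degree t, which vanishes iff p is not associated to
   Ext^(t+1)(T, C).  So S~_i holds for all i <= t, and S~_(t+1) fails exactly
   when (2) holds.  Depth is detected by Ext(k, -) as usual, through prime
   avoidance and Nakayama's lemma. *)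

(** * Linear maps and short exact sequences *)

Definition surjective (T U : Type) (f : T -> U) : Prop :=
  forall y, exists x, f x = y.

Section LinearMaps.
Variable R : comNzRingType.
Implicit Types U V W X Y A B D E K L P Q : lmodType R.

Definition mklinear U V (f : U -> V) (fP : linear f) : {linear U -> V} :=
  HB.pack f (GRing.isLinear.Build R U V *:%R f fP).

Lemma linear_congr U V (f g : {linear U -> V}) : f = g -> f =1 g.
Proof. by move->. Qed.

Lemma lkernelP U V (f : {linear U -> V}) x : x \in lkernel f <-> f x = 0.
Proof. by split=> /eqP. Qed.

Lemma limageP U V (f : {linear U -> V}) y :
  y \in limage f <-> exists x, f x = y.
Proof. by split=> /asboolP. Qed.

Lemma quotmod_pi_surj V (S : submod V) : surjective (quotmod_pi S).
Proof. by move=> x; exists (repr x); exact: quotmod_piK. Qed.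

Lemma quotmod_pi_eq0 V (S : submod V) x : quotmod_pi S x = 0 <-> x \in S.
Proof.
have E : (quotmod_pi S x == 0) = (x \in S).
  by rewrite -(linear0 (quotmod_pi S)) quotmod_piP subr0.
by rewrite -E; split=> /eqP.
Qed.

Fact corestrict_is_linear U V (S : submod V) (f : {linear U -> V})
    (fS : forall u, f u \in S) : linear (fun u => Submodule (fS u)).
Proof. by move=> a x y; apply: val_inj; rewrite /= linearP. Qed.
Definition corestrict U V (S : submod V) (f : {linear U -> V})
    (fS : forall u, f u \in S) : {linear U -> submodule S} :=
  mklinear (corestrict_is_linear fS).

Lemma factor_surj U V W (p : {linear U -> V}) (f : {linear U -> W}) :
  surjective p -> (forall u, p u = 0 -> f u = 0) ->
  exists g : {linear V -> W}, forall u, g (p u) = f u.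
Proof.
move=> p_surj kerP; have [s sP] := choice p_surj.
have fE u v : p u = p v -> f u = f v.
  by move=> e; apply/eqP; rewrite -subr_eq0 -linearB kerP // linearB e subrr.
have g_lin : linear (f \o s).
  by move=> a x y /=; rewrite -linearP; apply: fE; rewrite linearP !sP.
by exists (mklinear g_lin) => u /=; apply: fE; rewrite sP.
Qed.

Lemma factor_inj U V W (i : {linear V -> W}) (f : {linear U -> W}) :
  injective i -> (forall u, exists v, i v = f u) ->
  exists g : {linear U -> V}, forall u, i (g u) = f u.
Proof.
move=> i_inj imP; have [g gP] := choice imP.
have g_lin : linear g.
  by move=> a x y; apply: i_inj; rewrite linearP !gP linearP.
by exists (mklinear g_lin).
Qed.

Lemma projective_lift P V W (e : {linear V -> W}) (f : {linear P -> W}) :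
  projective P -> (forall x, exists v, e v = f x) ->
  exists g : {linear P -> V}, forall x, e (g x) = f x.
Proof.
move=> Pproj imP.
have eS v : e v \in limage e by apply/limageP; exists v.
have fS x : f x \in limage e by apply/limageP.
have [y|g gP] := Pproj _ _ (corestrict eS) (corestrict fS).
  by have /limageP[v vy] := valP y; exists v; apply: val_inj.
by exists g => x; have /(congr1 val) := gP x.
Qed.

Definition isomorphic U V : Prop :=
  exists2 f : {linear U -> V}, injective f & surjective f.

Lemma isomorphic_trans U V W :
  isomorphic U V -> isomorphic V W -> isomorphic U W.
Proof.
move=> [f f_inj f_surj] [g g_inj g_surj].
exists (g \o f); first exact: inj_comp.
by move=> w; have [v <-] := g_surj w; have [u <-] := f_surj v; exists u.
Qed.

Lemma isomorphic_sym U V : isomorphic U V -> isomorphic V U.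
Proof.
move=> [f f_inj f_surj].
have [g gK] := factor_inj (f := idfun) f_inj f_surj.
exists g => [x y e|u]; first by rewrite -[x]gK e gK.
by exists (f u); apply: f_inj; rewrite gK.
Qed.

Lemma isomorphic_same_kernel U V W (f : {linear U -> V}) (g : {linear U -> W}) :
  surjective f -> surjective g -> (forall u, f u = 0 <-> g u = 0) ->
  isomorphic V W.
Proof.
move=> f_surj g_surj kerE; have [u|h hP] := factor_surj (f := g) f_surj.
  by move/kerE.
exists h; last by move=> w; have [u <-] := g_surj w; exists (f u).
by apply: raddf_inj => v; have [u <-] := f_surj v; rewrite /= hP => /kerE.
Qed.

Lemma isomorphic_is_zero U V : isomorphic U V -> is_zero U <-> is_zero V.
Proof.
move=> [f f_inj f_surj]; split=> [U0 v|V0 u].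
  by have [u <-] := f_surj v; rewrite (U0 u) linear0.
by apply: f_inj; rewrite !(V0 (f _)).
Qed.

Lemma isomorphic_is_associated (p : prime_idealr R) U V :
  isomorphic U V -> is_associated p U <-> is_associated p V.
Proof.
suff imp A B : isomorphic A B -> is_associated p A -> is_associated p B.
  by move=> iUV; split; apply: imp => //; exact: isomorphic_sym.
move=> [f f_inj _] [x xP]; exists (f x) => a.
by rewrite xP -linearZ -(inj_eq f_inj) linear0.
Qed.

Fact linl_is_linear U V : linear (fun u : U => (u, 0) : U * V).
Proof. by move=> a x y; congr pair; rewrite /= scaler0 addr0. Qed.
Definition linl U V : {linear U -> (U * V)%type} :=
  mklinear (@linl_is_linear U V).

Fact linr_is_linear U V : linear (fun v : V => (0, v) : U * V).
Proof. by move=> a x y; congr pair; rewrite /= scaler0 addr0. Qed.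
Definition linr U V : {linear V -> (U * V)%type} :=
  mklinear (@linr_is_linear U V).

Fact lpair_is_linear U V W (f : {linear U -> V}) (g : {linear U -> W}) :
  linear (fun u => (f u, g u) : V * W).
Proof. by move=> a x y; rewrite !linearP. Qed.
Definition lpair U V W (f : {linear U -> V}) (g : {linear U -> W}) :
  {linear U -> (V * W)%type} := mklinear (lpair_is_linear f g).

Fact lcopair_is_linear U V W (f : {linear U -> W}) (g : {linear V -> W}) :
  linear (fun x : U * V => f x.1 + g x.2).
Proof. by move=> a x y; rewrite !linearP scalerDr addrACA. Qed.
Definition lcopair U V W (f : {linear U -> W}) (g : {linear V -> W}) :
  {linear (U * V)%type -> W} := mklinear (lcopair_is_linear f g).

Lemma projective_pair P Q :
  projective P -> projective Q -> projective (P * Q)%type.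
Proof.
move=> Pp Qp A B g f gs.
have [h hP] := Pp _ _ g (f \o linl P Q) gs.
have [k kP] := Qp _ _ g (f \o linr P Q) gs.
exists (lcopair h k) => -[x y] /=.
by rewrite linearD hP kP /= -linearD; congr (f (_, _)); rewrite ?addr0 ?add0r.
Qed.

Definition retract U V : Prop :=
  exists (s : {linear U -> V}) (r : {linear V -> U}), forall u, r (s u) = u.

Lemma retract_projective P Q : retract P Q -> projective Q -> projective P.
Proof.
move=> [s [r rs]] Qp A B g f gs; have [h hP] := Qp _ _ g (f \o r) gs.
by exists (h \o s) => x /=; rewrite hP /= rs.
Qed.

Lemma retract_fst U V : retract U (U * V)%type.
Proof. by exists (linl U V), fst. Qed.

Definition exact U V W (f : {linear U -> V}) (g : {linear V -> W}) : Prop :=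
  forall x, g x = 0 <-> exists y, f y = x.

Lemma exact_comp0 U V W (f : {linear U -> V}) (g : {linear V -> W}) x :
  exact f g -> g (f x) = 0.
Proof. by move=> ex; apply/ex; exists x. Qed.

Definition ses A B D (i : {linear A -> B}) (p : {linear B -> D}) : Prop :=
  [/\ injective i, surjective p & exact i p].

Lemma ses_comp0 A B D (i : {linear A -> B}) (p : {linear B -> D}) a :
  ses i p -> p (i a) = 0.
Proof. by case=> _ _; exact: exact_comp0. Qed.

Lemma ses_lkernel B D (p : {linear B -> D}) :
  surjective p -> ses (\val : {linear submodule (lkernel p) -> B}) p.
Proof.
move=> p_surj; split=> //; first exact: val_inj.
move=> b; split=> [/lkernelP kb|[a <-]]; last exact/lkernelP/(valP a).
by exists (Submodule kb).
Qed.

Lemma ses_linl_snd U V : ses (linl U V) (snd : {linear (U * V)%type -> V}).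
Proof.
split=> [x y []|y|[x y]] //; first by exists (0, y).
by split=> [/= ->|[a [_ <-]]] //; exists x.
Qed.

Lemma ses_split A B P (i : {linear A -> B}) (p : {linear B -> P}) :
  projective P -> ses i p -> exists r : {linear B -> A}, forall a, r (i a) = a.
Proof.
move=> Pp [i_inj p_surj exi]; have [s sP] := Pp _ _ p idfun p_surj.
have [|r rP] := factor_inj (f := idfun \- (s \o p)) i_inj.
  by move=> b; apply/exi; rewrite /= linearB sP subrr.
exists r => a; apply: i_inj.
by rewrite rP /= (exact_comp0 _ exi) linear0 subr0.
Qed.

Lemma ses_comp K A B D E (k : {linear K -> B}) (q : {linear B -> D})
    (i : {linear A -> D}) (p : {linear D -> E}) :
  ses k q -> ses i p ->
  exists (W : lmodType R) (w : {linear W -> B}) (j : {linear K -> W})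
         (r : {linear W -> A}),
    [/\ ses w (p \o q), ses j r & forall x, w (j x) = k x].
Proof.
move=> [k_inj q_surj exk] [i_inj p_surj exi].
have pq_surj : surjective (p \o q).
  move=> e; have [d <-] := p_surj e; have [b <-] := q_surj d.
  by exists b.
pose W := submodule (lkernel (p \o q)); pose w : {linear W -> B} := \val.
have kW x : k x \in lkernel (p \o q).
  by apply/lkernelP; rewrite /= (exact_comp0 _ exk) linear0.
have wP (x : W) : p (q (w x)) = 0 by exact/lkernelP/(valP x).
have [|r rP] := factor_inj (f := q \o w) i_inj.
  by move=> x; apply/exi; exact: wP.
exists W, w, (corestrict kW), r; split=> //; first exact: ses_lkernel.
split=> [x y /(congr1 val)/k_inj //|a|x].
  have [b qb] := q_surj (i a).
  have Wb : b \in lkernel (p \o q).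
    by apply/lkernelP; rewrite /= qb (exact_comp0 _ exi).
  by exists (Submodule Wb); apply: i_inj; rewrite rP.
split=> [rx|[y <-]]; last first.
  by apply: i_inj; rewrite rP linear0 /= (exact_comp0 _ exk).
have /exk[y yx] : q (w x) = 0 by rewrite -[LHS]rP rx linear0.
by exists y; apply: val_inj.
Qed.

(* A * P is the pullback of the two surjections onto D: it splits over P. *)
Lemma ses_pullback K P A B D (k : {linear K -> P}) (q : {linear P -> D})
    (i : {linear A -> B}) (p : {linear B -> D}) :
  projective P -> ses k q -> ses i p ->
  exists (l : {linear K -> A}) (g : {linear P -> B}),
    ses (lpair l k) (lcopair i g).
Proof.
move=> Pp [k_inj q_surj exk] [i_inj p_surj exi].
have [g gP] := Pp _ _ p q p_surj.
have [|l lP] := factor_inj (f := \- (g \o k)) i_inj.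
  by move=> x; apply/exi; rewrite /= linearN gP (exact_comp0 _ exk) oppr0.
exists l, g; split=> [x y [_ /k_inj//]|b|[a x] /=].
  have [x qx] := q_surj (p b).
  have /exi[a ia] : p (b - g x) = 0 by rewrite linearB gP qx subrr.
  by exists (a, x); rewrite /= ia subrK.
split=> [e|[y [<- <-]]]; last by rewrite lP addNr.
have /exk[y yx] : q x = 0.
  by rewrite -gP -[RHS](linear0 p) -e linearD (exact_comp0 _ exi) add0r.
exists y; rewrite -yx; congr pair; apply: i_inj.
by rewrite lP /= yx; apply/eqP; rewrite eq_sym -addr_eq0 e.
Qed.

(* Y splits as X + ker r. *)
Lemma ses_retract_complement X Y (s : {linear X -> Y}) (r : {linear Y -> X})
    K L P Q (i : {linear K -> P}) (p : {linear P -> X})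
    (j : {linear L -> Q}) (q : {linear Q -> submodule (lkernel r)}) :
  (forall x, r (s x) = x) -> ses i p -> ses j q ->
  ses (lpair (i \o fst) (j \o snd) : {linear (K * L)%type -> (P * Q)%type})
      (lcopair (s \o p) (\val \o q)).
Proof.
move=> rs [i_inj p_surj exi] [j_inj q_surj exj].
have rq y : r (val (q y)) = 0 by exact/lkernelP/(valP (q y)).
split=> [[x y] [x' y'] /= [/i_inj-> /j_inj->] //|y|[x y]].
  have ky : y - s (r y) \in lkernel r.
    by apply/lkernelP; rewrite linearB rs subrr.
  have [x px] := p_surj (r y); have [x' qx'] := q_surj (Submodule ky).
  by exists (x, x'); rewrite /= px qx' addrCA subrr addr0.
split=> [/= e|[[u v] [<- <-]]]; last first.
  by rewrite /= (exact_comp0 _ exi) (exact_comp0 _ exj) !linear0 addr0.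
have px : p x = 0 by rewrite -[LHS]rs -[LHS]addr0 -(rq y) -linearD e linear0.
have qy : q y = 0 by apply: val_inj; move: e; rewrite px linear0 add0r.
by have [/exi[u <-] /exj[v <-]] := (px, qy); exists (u, v).
Qed.

End LinearMaps.

(** * Vanishing of Ext in the first variable *)

Section ClosedClasses.
Variables (R : comNzRingType) (F : lmodType R -> Prop).
Implicit Types A B D K P X Y : lmodType R.

Definition retract_closed : Prop := forall X Y, retract X Y -> F Y -> F X.

Definition extension_closed : Prop :=
  forall A B D (i : {linear A -> B}) (p : {linear B -> D}),
    ses i p -> F A -> F D -> F B.

Lemma closed_ses_sub A B D (i : {linear A -> B}) (p : {linear B -> D})
    K P (k : {linear K -> P}) (q : {linear P -> D}) :
  retract_closed -> extension_closed ->
  ses i p -> projective P -> ses k q -> F B -> F K -> F A.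
Proof.
move=> Fr Fe sip Pp skq FB FK; have [l [g slg]] := ses_pullback Pp skq sip.
exact: Fr (retract_fst A P) (Fe _ _ _ _ _ slg FK FB).
Qed.

End ClosedClasses.

Section ExtVanish.
Variables (R : comNzRingType) (C : lmodType R).
Implicit Types A B D K P X Y : lmodType R.

Definition extends_along A B (i : {linear A -> B}) : Prop :=
  forall f : {linear A -> C},
    exists g : {linear B -> C}, forall a, g (i a) = f a.

Definition ext1_vanish X : Prop :=
  forall A B (i : {linear A -> B}) (p : {linear B -> X}),
    ses i p -> extends_along i.

(* [ext_vanish n X] says that Ext^(n+1)(X, C) = 0. *)
Fixpoint ext_vanish (n : nat) X : Prop :=
  match n with
  | 0 => ext1_vanish X
  | m.+1 => forall K P (i : {linear K -> P}) (p : {linear P -> X}),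
      projective P -> ses i p -> ext_vanish m K
  end.

Lemma free_ses X : exists K P (i : {linear K -> P}) (p : {linear P -> X}),
  projective P /\ ses i p.
Proof.
exists _, _, (\val : {linear submodule (lkernel (@free_cover R X)) -> _}).
exists (@free_cover R X); split; first exact: freeg_projective.
exact/ses_lkernel/free_cover_surj.
Qed.

Lemma ext_vanish_projective n P : projective P -> ext_vanish n P.
Proof.
elim: n P => [|n IHn] P Pp A B i p => [sip f|Bp sip];
  have [r ri] := ses_split Pp sip.
  by exists (f \o r) => a /=; rewrite ri.
by apply: IHn; apply: retract_projective Bp; exists i, r.
Qed.

Lemma ext_vanish_retract n : retract_closed (ext_vanish n).
Proof.
elim: n => [|n IHn] X Y [s [r rs]] Y0 A B i p => [sip f|Bp sip];
  have [L [Q [j [q [Qp sjq]]]]] := free_ses (submodule (lkernel r));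
  have sY := ses_retract_complement rs sip sjq.
  have [g gP] := Y0 _ _ _ _ sY (f \o fst).
  by exists (g \o linl _ _) => a; have /= := gP (a, 0); rewrite linear0.
exact: IHn (retract_fst A L) (Y0 _ _ _ _ (projective_pair Bp Qp) sY).
Qed.

Lemma ext_vanish_ses n : extension_closed (ext_vanish n).
Proof.
elim: n => [|n IHn] A B D i p sip A0 D0 K P k q => [skq f|Pp skq];
  have [W [w [j [r [sw sjr wj]]]]] := ses_comp skq sip.
  have [g gP] := A0 _ _ _ _ sjr f; have [h hP] := D0 _ _ _ _ sw g.
  by exists h => x; rewrite -wj hP.
have [L [Q [l [a [Qp sla]]]]] := free_ses A.
apply: (closed_ses_sub (@ext_vanish_retract n) IHn sjr Qp sla).
  exact: D0 Pp sw.
exact: A0 Qp sla.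
Qed.

Lemma ext_vanish_cover n X K P (i : {linear K -> P}) (p : {linear P -> X}) :
  projective P -> ses i p -> ext_vanish n K -> ext_vanish n.+1 X.
Proof.
move=> Pp sip K0 K' P' i' p' P'p sip'.
have P'0 := ext_vanish_projective n P'p.
exact: closed_ses_sub (@ext_vanish_retract n) (@ext_vanish_ses n)
  sip' Pp sip P'0 K0.
Qed.

Lemma ext_vanish_sub n A B D (i : {linear A -> B}) (p : {linear B -> D}) :
  ses i p -> ext_vanish n B -> ext_vanish n.+1 D -> ext_vanish n A.
Proof.
move=> sip B0 D0; have [K [P [k [q [Pp skq]]]]] := free_ses D.
exact: closed_ses_sub (@ext_vanish_retract n) (@ext_vanish_ses n)
  sip Pp skq B0 (D0 _ _ _ _ Pp skq).
Qed.

Lemma ext1_vanish_cover X K P (i : {linear K -> P}) (p : {linear P -> X}) :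
  projective P -> ses i p -> extends_along i -> ext1_vanish X.
Proof.
move=> Pp sip ext_i A B j q sjq f.
have [l [g [_ cs_surj exlc]]] := ses_pullback Pp sip sjq.
have [f' f'P] := ext_i (\- (f \o l)).
have [|h hP] := factor_surj (f := lcopair f f') cs_surj.
  by move=> _ /exlc[x <-]; rewrite /= f'P /= subrr.
by exists h => a; have /= := hP (a, 0); rewrite !linear0 !addr0.
Qed.

Definition acyclic X : Prop := forall n, ext_vanish n X.

Lemma acyclic_projective P : projective P -> acyclic P.
Proof. by move=> Pp n; exact: ext_vanish_projective. Qed.

Lemma acyclic_retract : retract_closed acyclic.
Proof. by move=> X Y rXY Y0 n; exact: ext_vanish_retract rXY (Y0 n). Qed.

Lemma acyclic_ses : extension_closed acyclic.
Proof.
by move=> A B D i p sip A0 D0 n; exact: ext_vanish_ses sip (A0 n) (D0 n).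
Qed.

Lemma acyclic_sub A B D (i : {linear A -> B}) (p : {linear B -> D}) :
  ses i p -> acyclic B -> acyclic D -> acyclic A.
Proof. by move=> sip B0 D0 n; exact: ext_vanish_sub sip (B0 n) (D0 n.+1). Qed.

End ExtVanish.

(** * Cohomology of complexes *)

Section Subquotients.
Variable R : comNzRingType.
Implicit Types V W : lmodType R.

Lemma subquot_is_zeroP V (Z B : submod V) :
  is_zero (subquot Z B) <-> {subset Z <= B}.
Proof.
split=> [ZB0 z Zz|ZB x].
  by have /quotmod_pi_eq0 := ZB0 (quotmod_pi _ (Submodule Zz)).
by have [[z Zz] <-] := quotmod_pi_surj x; apply/quotmod_pi_eq0/ZB.
Qed.

Lemma subquot_isomorphic V W (Z B : submod V) (Z' B' : submod W)
    (f : {linear V -> W}) :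
  {homo f : z / z \in Z >-> z \in Z'} -> {homo f : z / z \in B >-> z \in B'} ->
  (forall z, z \in Z -> f z \in B' -> z \in B) ->
  (forall z', z' \in Z' -> exists2 z, z \in Z & z' - f z \in B') ->
  isomorphic (subquot Z B) (subquot Z' B').
Proof.
move=> fZ fB f_inj f_surj.
have fZ' (z : submodule Z) : (f \o \val) z \in Z' by exact/fZ/(valP z).
pose q : {linear submodule Z -> subquot Z B} := quotmod_pi _.
pose q' : {linear submodule Z' -> subquot Z' B'} := quotmod_pi _.
apply: (isomorphic_same_kernel (f := q) (g := q' \o corestrict fZ')).
- exact: quotmod_pi_surj.
- move=> y; have [[z' Zz'] <-] := quotmod_pi_surj y.
  have [z Zz zz'] := f_surj z' Zz'; exists (Submodule Zz).
  apply/eqP; rewrite eq_sym -subr_eq0 -linearB; apply/eqP.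
  exact/quotmod_pi_eq0.
- move=> z; rewrite !quotmod_pi_eq0; split; first exact: fB.
  exact/f_inj/(valP z).
Qed.

End Subquotients.

Section Cohomology.
Variables (R : comNzRingType) (K : nat -> lmodType R).
Variable dK : forall n, {linear K n -> K n.+1}.

Definition is_complex : Prop := forall n x, dK n.+1 (dK n x) = 0.

Definition boundaries (n : nat) : submod (K n) :=
  match n with
  | 0 => submod0 _
  | m.+1 => limage (dK m)
  end.

Definition cohomology (n : nat) : lmodType R :=
  subquot (lkernel (dK n)) (boundaries n).

Definition exact_at (n : nat) : Prop :=
  forall z, dK n z = 0 -> z \in boundaries n.

Lemma cohomology_is_zeroP n : is_zero (cohomology n) <-> exact_at n.
Proof.
rewrite subquot_is_zeroP.
by split=> ex z; [move=> /lkernelP/ex|move=> /lkernelP/ex].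
Qed.

Lemma boundary_cocycle n z : is_complex -> z \in boundaries n -> dK n z = 0.
Proof.
move=> cplx; case: n z => [|n] z; first by move/eqP->; exact: linear0.
by move=> /limageP[y <-].
Qed.

End Cohomology.

Section LongExactSequence.
Variables (R : comNzRingType) (A B D : nat -> lmodType R).
Variables (dA : forall n, {linear A n -> A n.+1}).
Variables (dB : forall n, {linear B n -> B n.+1}).
Variables (dD : forall n, {linear D n -> D n.+1}).
Variable i : forall n, {linear A n -> B n}.
Variable p : forall n, {linear B n -> D n}.
Hypothesis sip : forall n, ses (i n) (p n).
Hypothesis iC : forall n x, i n.+1 (dA n x) = dB n (i n x).
Hypothesis pC : forall n x, p n.+1 (dB n x) = dD n (p n x).
Hypothesis complexB : is_complex dB.

Lemma ses_boundary_lift n b : p n b \in boundaries dD n ->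
  exists2 b', b' \in boundaries dB n & p n b' = p n b.
Proof.
case: n b => [|n] b; first by move=> /eqP->; exists 0; rewrite ?rpred0 ?linear0.
move=> /limageP[d dE]; have [_ p_surj _] := sip n; have [b' b'd] := p_surj d.
by exists (dB n b'); [apply/limageP; exists b'|rewrite pC b'd].
Qed.

Lemma ses_boundary_image n b :
  b \in boundaries dB n -> p n b \in boundaries dD n.
Proof.
case: n b => [|n] b; first by move=> /eqP->; rewrite linear0 rpred0.
by move=> /limageP[c <-]; rewrite pC; apply/limageP; exists (p n c).
Qed.

(* H^(n+1)(A) embeds into H^(n+1)(B) as soon as H^n(D) = 0. *)
Lemma ses_boundary_reflect n z :
  exact_at dD n -> i n.+1 z \in boundaries dB n.+1 -> z \in boundaries dA n.+1.
Proof.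
move=> exD /limageP[b bE].
have [|b' Bb' pb'] := @ses_boundary_lift n b.
  by apply: exD; rewrite -pC bE (ses_comp0 _ (sip _)).
have [_ _ exip] := sip n; have /exip[a aE] : p n (b - b') = 0.
  by rewrite linearB pb' subrr.
apply/limageP; exists a; have [i_inj _ _] := sip n.+1; apply: i_inj.
by rewrite iC aE linearB bE (boundary_cocycle complexB Bb') subr0.
Qed.

Lemma ses_exact_at_quot n : exact_at dB n -> exact_at dA n.+1 -> exact_at dD n.
Proof.
move=> exB exA z dz; have [_ p_surj _] := sip n; have [b bz] := p_surj z.
have [_ _ exip] := sip n.+1; have /exip[a aE] : p n.+1 (dB n b) = 0.
  by rewrite pC bz.
have /limageP[a' a'E] : a \in boundaries dA n.+1.
  apply: exA; have [i_inj _ _] := sip n.+2; apply: i_inj.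
  by rewrite iC aE complexB linear0.
have -> : z = p n (b - i n a').
  by rewrite linearB bz (ses_comp0 _ (sip n)) subr0.
by apply/ses_boundary_image/exB; rewrite linearB -iC a'E aE subrr.
Qed.

End LongExactSequence.

Section HomComplex.
Variables (R : comNzRingType) (X : nat -> lmodType R).
Variable D : forall n, {linear X n.+1 -> X n}.
Implicit Types C N : lmodType R.

Definition hom_d N n : {linear {linear X n -> N} -> {linear X n.+1 -> N}} :=
  hom_pre N (D n).

Lemma hom_cocycleP N n (z : {linear X n -> N}) :
  hom_d N n z = 0 <-> forall y, z (D n y) = 0.
Proof. by split=> [/linear_congr//|zD]; exact: linear_ext. Qed.

Lemma hom_boundaryP N n (z : {linear X n.+1 -> N}) :
  z \in boundaries (hom_d N) n.+1 <->
  exists g : {linear X n -> N}, forall x, z x = g (D n x).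
Proof.
split=> [/limageP[g <-]|[g gE]]; first by exists g.
by apply/limageP; exists g; apply: linear_ext => x; rewrite gE.
Qed.

Lemma hom_exact_atP N n :
  exact_at (hom_d N) n.+1 <->
  forall z : {linear X n.+1 -> N}, (forall y, z (D n.+1 y) = 0) ->
    exists g : {linear X n -> N}, forall x, z x = g (D n x).
Proof.
split=> [ex z /hom_cocycleP/ex/hom_boundaryP//|ex z /hom_cocycleP/ex].
by move/hom_boundaryP.
Qed.

Definition is_chain_complex : Prop := forall n x, D n (D n.+1 x) = 0.

Lemma hom_complex N : is_chain_complex -> is_complex (hom_d N).
Proof.
move=> cplx n f; apply: linear_ext => x.
by rewrite -[LHS]/(f (D n (D n.+1 x))) cplx linear0.
Qed.

Definition exact_chain : Prop :=
  surjective (D 0) /\ forall n, exact (D n.+1) (D n).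

Definition cycles (n : nat) : lmodType R :=
  match n with
  | 0 => X 0
  | m.+1 => submodule (lkernel (D m))
  end.

Definition cycles_incl (n : nat) : {linear cycles n -> X n} :=
  match n with
  | 0 => idfun
  | m.+1 => \val
  end.

Lemma exact_chain_ses n : exact_chain ->
  exists2 e : {linear X n.+1 -> cycles n},
    ses (cycles_incl n.+1) e & forall x, cycles_incl n (e x) = D n x.
Proof.
move=> [D_surj exD]; case: n => [|n].
  by exists (D 0) => //; exact: ses_lkernel.
have DZ x : D n.+1 x \in lkernel (D n) by apply/lkernelP/exD; exists x.
exists (corestrict DZ) => //; split=> [|z|x]; first exact: val_inj.
  have /lkernelP/exD[x xz] := valP z.
  by exists x; apply: val_inj.
split=> [/(congr1 val)/= /lkernelP Zx|[z <-]]; first by exists (Submodule Zx).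
by apply: val_inj; exact/lkernelP/(valP z).
Qed.

Lemma exact_chain_acyclic_cycles C n :
  exact_chain -> (forall m, acyclic C (X m)) -> acyclic C (cycles n).
Proof.
move=> exX Xac; elim: n => [|n IHn]; first exact: Xac.
by have [e se _] := exact_chain_ses n exX; exact: acyclic_sub se (Xac _) IHn.
Qed.

Lemma hom_exact_chain C n :
  exact_chain -> (forall m, acyclic C (X m)) -> exact_at (hom_d C) n.+1.
Proof.
move=> exX Xac; apply/hom_exact_atP => f fD.
have [e se eD] := exact_chain_ses n exX; have [_ e_surj _] := se.
have [|h hP] := factor_surj (f := f) e_surj.
  have [_ ex] := exX; move=> x ex0; have /ex[y <-] : D n x = 0.
    by rewrite -eD ex0 linear0.
  exact: fD.
have [g gP] : exists g : {linear X n -> C}, forall z, g (cycles_incl n z) = h z.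
  case: n e se eD f fD {e_surj} h hP => [|n] e _ _ f _ h _.
    by exists h.
  have [e' se' _] := exact_chain_ses n exX.
  exact: (exact_chain_acyclic_cycles n exX Xac 0%N _ _ _ _ se' h).
by exists g => x; rewrite -hP -gP eD.
Qed.

End HomComplex.

(** * Ext through acyclic resolutions *)

Section ExtOf.
Variables (R : comNzRingType) (X : lmodType R) (G : resolution X).
Implicit Types N : lmodType R.

Lemma res_chain_complex : is_chain_complex (res_d G).
Proof. by move=> n x; apply/res_exact; exists x. Qed.

Lemma Ext_of_is_zeroP N j :
  is_zero (Ext_of G N j) <-> exact_at (hom_d (res_d G) N) j.
Proof. exact: cohomology_is_zeroP. Qed.

End ExtOf.

Lemma Ext_zero_acyclic (R : comNzRingType) (C X : lmodType R) :
  (forall i, (1 <= i)%N -> is_zero (Ext i X C)) -> acyclic C X.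
Proof.
move=> E0 n; suff: forall m, ext_vanish C n (syzygy X m) by move/(_ 0%N).
have sm m :
    ses (\val : {linear syzygy X m.+1 -> _}) (@free_cover R (syzygy X m)).
  exact/ses_lkernel/free_cover_surj.
elim: n => [|n IHn] m; last first.
  exact: (ext_vanish_cover (@freeg_projective _ _) (sm m) (IHn m.+1)).
apply: (ext1_vanish_cover (@freeg_projective _ _) (sm m)) => f.
have /Ext_of_is_zeroP/hom_exact_atP ext0 := E0 m.+1 isT.
have [y|g gE] := ext0 (f \o @free_cover R (syzygy X m.+1)).
  have dy : free_cover (std_d X m.+1 y) = 0 by apply/std_d_exact; exists y.
  by rewrite -[LHS]/(f (free_cover (std_d X m.+1 y))) dy linear0.
by exists g => a; have [y <-] := free_cover_surj a; have /= -> := gE y.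
Qed.

Lemma dependent_choice_family (A : nat -> Type) (good : forall n, A n -> Prop)
    (rel : forall n, A n -> A n.+1 -> Prop) (x0 : A 0%N) :
  good 0%N x0 ->
  (forall n x, good n x -> exists y, good n.+1 y /\ rel n x y) ->
  exists f : forall n, A n, f 0%N = x0 /\ forall n, rel n (f n) (f n.+1).
Proof.
move=> g0 step.
pose next n (x : {x : A n | good n x}) : {y : A n.+1 | good n.+1 y} :=
  let y := cid (step n (sval x) (svalP x)) in exist _ (sval y) (svalP y).1.
pose f := fix f n : {x : A n | good n x} :=
  match n with 0 => exist _ x0 g0 | m.+1 => next m (f m) end.
exists (fun n => sval (f n)); split=> // n /=.
by case: (cid _) => y [].
Qed.

Section AcyclicResolution.
Variables (R : comNzRingType) (T C : lmodType R) (G : resolution T).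
Variables (Q : nat -> lmodType R) (q : forall n, {linear Q n.+1 -> Q n}).
Variable eps : {linear Q 0%N -> T}.
Hypothesis eps_surj : surjective eps.
Hypothesis eps_exact : exact (q 0) eps.
Hypothesis q_exact : forall n, exact (q n.+1) (q n).
Hypothesis Q_acyclic : forall n, acyclic C (Q n).

Let d n : {linear res_obj G n.+1 -> res_obj G n} := res_d G n.
Let dd : is_chain_complex d.
Proof. exact: res_chain_complex. Qed.
Let qq : is_chain_complex q.
Proof. by move=> n x; apply/q_exact; exists x. Qed.

Lemma resolution_lift :
  exists phi : forall n, {linear res_obj G n -> Q n},
    (forall x, eps (phi 0%N x) = res_aug G x) /\
    forall n x, q n (phi n.+1 x) = phi n (d n x).
Proof.
have [phi0 phi0P] := @res_projective _ _ G 0 _ _ eps (res_aug G) eps_surj.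
pose good n (f : {linear res_obj G n -> Q n}) :=
  forall y, exists w, q n w = f (d n y).
pose rel n (f : {linear res_obj G n -> Q n})
    (f' : {linear res_obj G n.+1 -> Q n.+1}) :=
  forall x, q n (f' x) = f (d n x).
have [||phi [phi00 phiP]] := @dependent_choice_family _ good rel phi0.
- move=> y; apply/eps_exact; rewrite phi0P.
  by apply/res_exact0; exists y.
- move=> n f gf.
  have [f' f'P] :=
    projective_lift (e := q n) (f := f \o d n) (res_projective (n := n.+1)) gf.
  exists f'; split=> // y; apply/q_exact.
  by rewrite f'P /= dd linear0.
- by exists phi; split=> // x; rewrite phi00.
Qed.

(* The cone of a lift phi of the identity of T is an exact complex of acyclic
   modules; Hom(-, C) keeps it exact, so that Hom(phi, C) induces isomorphisms
   in cohomology. *)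
Section Cone.
Variable phi : forall n, {linear res_obj G n -> Q n}.
Hypothesis phi_aug : forall x, eps (phi 0%N x) = res_aug G x.
Hypothesis phi_comm : forall n x, q n (phi n.+1 x) = phi n (d n x).

Definition cone (n : nat) : lmodType R :=
  match n with
  | 0 => Q 0%N
  | m.+1 => (res_obj G m * Q m.+1)%type
  end.

Definition cone_d (n : nat) : {linear cone n.+1 -> cone n} :=
  match n with
  | 0 => lcopair (phi 0%N) (q 0%N)
  | m.+1 => lpair (\- (d m \o fst)) (lcopair (phi m.+1) (q m.+1))
  end.

Lemma cone_surj : surjective (cone_d 0).
Proof.
move=> x; have [p pP] := @res_aug_surj _ _ G (eps x).
have /eps_exact[y yP] : eps (x - phi 0%N p) = 0.
  by rewrite linearB phi_aug pP subrr.
by exists (p, y); rewrite /= yP addrC subrK.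
Qed.

Lemma cone_boundary n p y : (exists w, d n w = p) -> phi n p + q n y = 0 ->
  exists w, cone_d n.+1 w = (p, y).
Proof.
move=> [u up] e; have /q_exact[v vP] : q n (y + phi n.+1 u) = 0.
  by rewrite linearD phi_comm up addrC.
by exists (- u, v); rewrite /= !linearN opprK up vP addrC addrK.
Qed.

Lemma cone_exact n : exact (cone_d n.+1) (cone_d n).
Proof.
case: n => [|n] [p y]; split=> [e|[[u v] [<- <-]]].
- apply: cone_boundary => //; apply/res_exact0.
  have epsq : eps (q 0%N y) = 0 by apply/eps_exact; exists y.
  by rewrite -phi_aug -[LHS]addr0 -epsq -linearD [_ + _]e linear0.
- by rewrite /= linearN linearD phi_comm qq addr0 addNr.
- have [/eqP] := e; rewrite oppr_eq0 => /eqP dp e'.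
  by apply: cone_boundary => //; exact/res_exact.
- rewrite /= [d n _]linearN dd opprK.
  by rewrite linearN linearD phi_comm qq addr0 addNr.
Qed.

Lemma cone_acyclic n : acyclic C (cone n).
Proof.
case: n => [|n] //=; apply: acyclic_ses (ses_linl_snd _ _) _ (Q_acyclic _).
exact/acyclic_projective/res_projective.
Qed.

Lemma hom_cone_exact n : exact_at (hom_d cone_d C) n.+1.
Proof.
exact: hom_exact_chain (conj cone_surj cone_exact) cone_acyclic.
Qed.

Lemma cohomology_lift_surj i (z : {linear res_obj G i.+1 -> C}) :
  z \in lkernel (hom_d d C i.+1) ->
  exists2 v : {linear Q i.+1 -> C}, v \in lkernel (hom_d q C i.+1) &
    z - hom_pre C (phi i.+1) v \in boundaries (hom_d d C) i.+1.
Proof.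
move=> /lkernelP/hom_cocycleP zd.
have /hom_exact_atP ex := @hom_cone_exact i.+1.
have [[p y]|g gP] := ex (z \o fst); first by rewrite /= linearN zd oppr0.
exists (g \o linr _ _).
  apply/lkernelP/hom_cocycleP => y.
  by have := gP (0, y); rewrite /= !linear0 add0r => <-.
apply/hom_boundaryP; exists (\- (g \o linl _ _)) => x.
have := gP (x, 0); rewrite /= linear0 addr0 => zx.
rewrite -[LHS]/(z x - g (0, phi i.+1 x)) zx -linearB -[RHS]linearN.
by congr (g (_, _)); rewrite /= ?subr0 ?subrr ?oppr0.
Qed.

Lemma cohomology_lift_inj i (z : {linear Q i.+1 -> C}) :
  z \in lkernel (hom_d q C i.+1) ->
  hom_pre C (phi i.+1) z \in boundaries (hom_d d C) i.+1 ->
  z \in boundaries (hom_d q C) i.+1.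
Proof.
move=> /lkernelP/hom_cocycleP zq /hom_boundaryP[u zu].
have /hom_exact_atP ex := @hom_cone_exact i.
have [[p y]|g gP] := ex (lcopair u z).
  rewrite /= linearN linearD zq addr0.
  by have /= -> := zu p; rewrite addNr.
apply/hom_boundaryP.
case: i z u {zq zu ex} g gP => [|i] z u g gP.
  by exists g => y; have := gP (0, y); rewrite /= !linear0 !add0r.
exists (g \o linr _ _) => y.
by have := gP (0, y); rewrite /= !linear0 !add0r.
Qed.

End Cone.

Theorem Ext_of_acyclic_resolution i :
  isomorphic (Ext_of G C i.+1) (cohomology (hom_d q C) i.+1).
Proof.
have [phi [phi_aug phi_comm]] := resolution_lift.
apply: isomorphic_sym; apply: (subquot_isomorphic (f := hom_pre C (phi i.+1))).
- move=> z /lkernelP/hom_cocycleP zq; apply/lkernelP/hom_cocycleP => y.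
  by rewrite /= -phi_comm zq.
- move=> z /hom_boundaryP[g gP]; apply/hom_boundaryP.
  by exists (g \o phi i) => x; rewrite /= gP phi_comm.
- exact: (cohomology_lift_inj phi_aug phi_comm (i := i)).
- exact: (cohomology_lift_surj phi_aug phi_comm (i := i)).
Qed.

End AcyclicResolution.

(** * Finitely generated modules *)

Section FinitelyGenerated.
Variable R : comNzRingType.
Implicit Types A B D U V W P : lmodType R.

Lemma fg_surj U V (f : {linear U -> V}) :
  surjective f -> finitely_generated U -> finitely_generated V.
Proof.
move=> f_surj [n [g gP]]; exists n, (f \o g) => v.
have [u <-] := f_surj v; have [c ->] := gP u; exists c.
by rewrite linear_sum; apply: eq_bigr => i _; rewrite linearZ.
Qed.

Lemma fg_submoduleP V (U : submod V) :
  finitely_generated (submodule U) <->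
  exists n (g : 'I_n -> V), (forall i, g i \in U) /\
    forall x, x \in U -> exists c : 'I_n -> R, x = \sum_(i < n) c i *: g i.
Proof.
pose v : {linear submodule U -> V} := \val.
split=> [[n [g gP]]|[n [g [gU gP]]]].
  exists n, (v \o g); split=> [i|x Ux]; first exact: (valP (g i)).
  have [c cE] := gP (Submodule Ux); exists c.
  rewrite -[LHS]/(v (Submodule Ux)) cE linear_sum.
  by apply: eq_bigr => i _; rewrite linearZ.
exists n, (fun i => Submodule (gU i)) => x.
have [c cE] := gP (v x) (valP x); exists c; apply: val_inj.
rewrite -[LHS]/(v x) cE -[RHS]/(v _) linear_sum.
by apply: eq_bigr => i _; rewrite linearZ.
Qed.

Lemma fg_retract : retract_closed (@finitely_generated R).
Proof.
by move=> X Y [s [r rs]]; apply: (fg_surj (f := r)) => x; exists (s x).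
Qed.

Lemma fg_pair U V :
  finitely_generated U -> finitely_generated V ->
  finitely_generated (U * V)%type.
Proof.
move=> [n [g gP]] [m [h hP]].
exists (n + m)%N, (fun i => match split i with
  | inl j => linl U V (g j) | inr k => linr U V (h k) end) => -[u v].
have [c uE] := gP u; have [e vE] := hP v.
exists (fun i => match split i with inl j => c j | inr k => e k end).
rewrite big_split_ord.
transitivity (linl U V u + linr U V v).
  by congr pair; rewrite /= ?addr0 ?add0r.
rewrite uE vE !linear_sum; congr (_ + _); apply: eq_bigr => i _.
  by rewrite (unsplitK (inl _ i)) linearZ.
by rewrite (unsplitK (inr _ i)) linearZ.
Qed.

Fact lincomb_is_linear n V (g : 'I_n -> V) :
  linear (fun v : 'rV[R]_n => \sum_(i < n) v 0 i *: g i).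
Proof.
move=> a x y; rewrite scaler_sumr -big_split; apply: eq_bigr => i _ /=.
by rewrite !mxE scalerDl scalerA.
Qed.
Definition lincomb n V (g : 'I_n -> V) : {linear 'rV[R]_n -> V} :=
  mklinear (lincomb_is_linear g).

Lemma rV_projective n : projective 'rV[R]_n.
Proof.
move=> A B g f g_surj.
have [h hP] := choice (fun i : 'I_n => g_surj (f (delta_mx 0 i))).
exists (lincomb h) => x /=.
rewrite linear_sum [in RHS](row_sum_delta x) linear_sum.
by apply: eq_bigr => i _; rewrite !linearZ /= hP.
Qed.

Lemma rV_fg n : finitely_generated 'rV[R]_n.
Proof.
exists n, (fun i => delta_mx 0 i) => x; exists (fun i => x 0 i).
exact: row_sum_delta.
Qed.

Lemma fg_rV_cover V : finitely_generated V ->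
  exists n (f : {linear 'rV[R]_n -> V}), surjective f.
Proof.
move=> [n [g gP]]; exists n, (lincomb g) => v.
have [c ->] := gP v; exists (\row_i c i) => /=.
by apply: eq_bigr => i _; rewrite mxE.
Qed.

Lemma fg_ses : extension_closed (@finitely_generated R).
Proof.
move=> A B D i p [_ p_surj exip] fgA fgD.
have [n [f f_surj]] := fg_rV_cover fgD.
have [g gP] := rV_projective f p_surj.
apply: (fg_surj (f := lcopair i g)) (fg_pair fgA (rV_fg n)) => b.
have [x fx] := f_surj (p b).
have /exip[a ia] : p (b - g x) = 0 by rewrite linearB gP fx subrr.
by exists (a, x); rewrite /= ia subrK.
Qed.

Definition noetherian_module V : Prop :=
  forall U : submod V, finitely_generated (submodule U).

Lemma noetherian_module_inj_fg U V (f : {linear U -> V}) :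
  injective f -> noetherian_module V -> finitely_generated U.
Proof.
move=> f_inj /(_ (limage f)).
have fP u : f u \in limage f by apply/limageP; exists u.
pose incl : {linear submodule (limage f) -> V} := \val.
apply: fg_retract; have [v|r rP] := factor_inj (f := incl) f_inj.
  exact/limageP/(valP v).
by exists (corestrict fP), r => u; apply: f_inj; rewrite rP.
Qed.

Lemma noetherian_module_surj U V (f : {linear U -> V}) :
  surjective f -> noetherian_module U -> noetherian_module V.
Proof.
move=> f_surj noethU S.
have fS (u : submodule (lpreimage f S)) : (f \o \val) u \in S.
  exact: (valP u).
apply: (fg_surj (f := corestrict fS)) (noethU _) => v.
have [u fu] := f_surj (val v).
have Su : u \in lpreimage f S by rewrite inE fu; exact: (valP v).
by exists (Submodule Su); apply: val_inj.
Qed.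

Lemma noetherian_module_retract : retract_closed (@noetherian_module).
Proof.
move=> X Y [s [r rs]]; apply: (noetherian_module_surj (f := r)) => x.
by exists (s x).
Qed.

Lemma noetherian_module_ses : extension_closed (@noetherian_module).
Proof.
move=> A B D i p [i_inj _ exip] noethA noethD S.
pose v : {linear submodule S -> B} := \val.
have pvP x : (p \o v) x \in limage (p \o v) by apply/limageP; exists x.
have pv_surj : surjective (corestrict pvP).
  by move=> d; have /limageP[x xd] := valP d; exists x; apply: val_inj.
apply: fg_ses (ses_lkernel pv_surj) _ (noethD _).
pose k : {linear submodule (lkernel (corestrict pvP)) -> B} := v \o \val.
have [x|j jP] := factor_inj (f := k) i_inj.
  by apply/exip; have /lkernelP/(congr1 val) := valP x.
apply: (noetherian_module_inj_fg (f := j)) noethA => x y /(congr1 i).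
by rewrite !jP => /val_inj/val_inj.
Qed.

(* V is a direct summand of a finite direct sum of copies of U. *)
Definition in_add U V : Prop :=
  exists n (i : 'I_n -> {linear U -> V}) (p : 'I_n -> {linear V -> U}),
    forall v, v = \sum_(k < n) i k (p k v).

Lemma in_add_retract U V W : retract V W -> in_add U W -> in_add U V.
Proof.
move=> [s [r rs]] [n [i [p ipP]]].
exists n, (fun k => r \o i k), (fun k => p k \o s) => v.
by rewrite -[LHS]rs [s v]ipP linear_sum.
Qed.

Lemma in_add_ind (F : lmodType R -> Prop) U V :
  retract_closed F -> extension_closed F -> F U -> in_add U V -> F V.
Proof.
move=> Fr Fe FU [n [i [p ipP]]].
suff [W [FW [s [r rs]]]] : exists W, F W /\ exists (s : {linear V -> W})
    (r : {linear W -> V}), forall v, r (s v) = \sum_(k < n) i k (p k v).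
  by apply: Fr FW; exists s, r => v; rewrite rs -ipP.
elim: n i p {ipP} => [|n IHn] i p.
  by exists U; split=> //; exists \0, \0 => v; rewrite big_ord0.
have [W [FW [s [r rs]]]] := IHn (i \o lift ord0) (p \o lift ord0).
exists (U * W)%type; split; first exact: Fe (ses_linl_snd _ _) FU FW.
exists (lpair (p ord0) s), (lcopair (i ord0) r) => v.
by rewrite big_ord_recl /= rs.
Qed.

Lemma rV_in_add n : in_add R^o 'rV[R]_n.
Proof.
have i_lin k : linear (fun r : R^o => r *: delta_mx 0 k : 'rV[R]_n).
  by move=> a x y; rewrite scalerDl scalerA.
have p_lin k : linear (fun v : 'rV[R]_n => v 0 k : R^o).
  by move=> a x y; rewrite !mxE.
exists n, (fun k => mklinear (i_lin k)), (fun k => mklinear (p_lin k)) => v.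
exact: row_sum_delta.
Qed.

Lemma fg_projective_in_add P :
  finitely_generated P -> projective P -> in_add R^o P.
Proof.
move=> /fg_rV_cover[n [f f_surj]] Pp; have [s sP] := Pp _ _ f idfun f_surj.
by apply: in_add_retract (rV_in_add n); exists s, f.
Qed.

Lemma fg_noetherian V :
  noetherian R -> finitely_generated V -> noetherian_module V.
Proof.
move=> noethR /fg_rV_cover[n [f f_surj]].
apply: (noetherian_module_surj f_surj).
apply: (in_add_ind _ _ _ (rV_in_add n)) => //.
  exact: noetherian_module_retract.
exact: noetherian_module_ses.
Qed.

Lemma in_add_fg U V :
  finitely_generated U -> in_add U V -> finitely_generated V.
Proof. exact: in_add_ind fg_retract fg_ses. Qed.

Lemma in_add_acyclic C U V : acyclic C U -> in_add U V -> acyclic C V.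
Proof. exact: in_add_ind (@acyclic_retract _ _) (@acyclic_ses _ _). Qed.

Lemma fg_cover V : noetherian R -> finitely_generated V ->
  exists P (f : {linear P -> V}), [/\ surjective f, projective P, in_add R^o P &
    finitely_generated (submodule (lkernel f))].
Proof.
move=> noethR /fg_rV_cover[n [f f_surj]]; exists 'rV[R]_n, f; split=> //.
- exact: rV_projective.
- exact: rV_in_add.
- exact/(fg_noetherian noethR)/rV_fg.
Qed.

Lemma fg_resolution_exists V : noetherian R -> finitely_generated V ->
  exists G : resolution V, forall n, in_add R^o (res_obj G n).
Proof.
move=> noethR fgV; pose fgmod := {X : lmodType R | finitely_generated X}.
have cover (X : fgmod) : {P : lmodType R & {f : {linear P -> sval X} |
    [/\ surjective f, projective P, in_add R^o P &
        finitely_generated (submodule (lkernel f))]}}.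
  by have /cid[P /cid[f fP]] := fg_cover noethR (svalP X); exists P, f.
pose obj X := projT1 (cover X); pose aug X := sval (projT2 (cover X)).
have augP X : [/\ surjective (aug X), projective (obj X), in_add R^o (obj X) &
    finitely_generated (submodule (lkernel (aug X)))].
  exact: svalP (projT2 (cover X)).
have aug_surj X : surjective (aug X) by case: (augP X).
have aug_fg X : finitely_generated (submodule (lkernel (aug X))).
  by case: (augP X).
pose syz n : fgmod := iter n (fun X => exist _ _ (aug_fg X)) (exist _ V fgV).
pose d n : {linear obj (syz n.+1) -> obj (syz n)} :=
  (\val : {linear submodule (lkernel (aug (syz n))) -> _}) \o aug (syz n.+1).
have d_exact n : exact (d n) (aug (syz n)).
  move=> x; split=> [/lkernelP Kx|[y <-]].
    have [y yx] := aug_surj (syz n.+1) (Submodule Kx).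
    by exists y; rewrite /d /= yx.
  exact/lkernelP/(valP (aug (syz n.+1) y)).
have d_proj n : projective (obj (syz n)) by case: (augP (syz n)).
have dd_exact n x : d n x = 0 <-> exists y, d n.+1 y = x.
  rewrite -d_exact; split=> [dx0|xP]; first exact: val_inj.
  by rewrite /d /= xP.
exists (Resolution d_proj (aug_surj (syz 0)) (d_exact 0) dd_exact) => n.
by case: (augP (syz n)).
Qed.

End FinitelyGenerated.

(** * A complex computing Ext(Tr M, C) *)

Section Bidual.
Variables (R : comNzRingType) (C : lmodType R).
Implicit Types P : lmodType R.

Fact tensor_hom_is_linear P (p : {linear P -> R^o}) (c : C) :
  linear (fun x => (p x : R) *: c).
Proof. by move=> a x y; rewrite linearP scalerDl scalerA. Qed.

Fact tensor_homr_is_linear P (p : {linear P -> R^o}) :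
  linear (fun c => mklinear (tensor_hom_is_linear p c)).
Proof.
move=> a c c'; apply: linear_ext => x /=.
by rewrite scalerDr !scalerA mulrC.
Qed.
Definition tensor_hom P (p : {linear P -> R^o}) :
    {linear C -> {linear P -> C}} :=
  mklinear (tensor_homr_is_linear p).

Fact hom_eval_is_linear P (x : P) : linear (fun f : {linear P -> C} => f x).
Proof. by []. Qed.

Fact bidual_eval_is_linear P :
  linear (fun x : P => mklinear (hom_eval_is_linear x)).
Proof. by move=> a x y; apply: linear_ext => f /=; rewrite linearP. Qed.
Definition bidual_eval P : {linear P -> {linear {linear P -> C} -> C}} :=
  mklinear (@bidual_eval_is_linear P).

Lemma hom_dual_basis P n (i : 'I_n -> {linear R^o -> P})
    (p : 'I_n -> {linear P -> R^o}) :
  (forall v, v = \sum_(k < n) i k (p k v)) ->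
  forall f : {linear P -> C}, f = \sum_(k < n) tensor_hom (p k) (f (i k 1)).
Proof.
move=> ipP f; apply: linear_ext => x.
rewrite -[RHS]/(bidual_eval P x (\sum_(k < n) tensor_hom (p k) (f (i k 1)))).
rewrite linear_sum [in LHS](ipP x) linear_sum; apply: eq_bigr => k _ /=.
by rewrite -!linearZ /= -[in LHS](mulr1 (p k x)).
Qed.

Lemma hom_in_add P : in_add R^o P -> in_add C {linear P -> C}.
Proof.
move=> [n [i [p ipP]]].
exists n, (fun k => tensor_hom (p k)), (fun k => bidual_eval P (i k 1)) => f.
exact: hom_dual_basis.
Qed.

Lemma bidual_eval_inj P : injective (homothety C) -> in_add R^o P ->
  injective (bidual_eval P).
Proof.
move=> hC_inj [n [i [p ipP]]]; apply: raddf_inj => x /linear_congr/= x0.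
rewrite [x]ipP big1 // => k _; suff -> : p k x = 0 by rewrite linear0.
apply: hC_inj; apply: linear_ext => c /=.
by rewrite scale0r; have := x0 (tensor_hom (p k) c).
Qed.

Lemma bidual_eval_surj P : surjective (homothety C) -> in_add R^o P ->
  surjective (bidual_eval P).
Proof.
move=> hC_surj [n [i [p ipP]]] F.
have [r rP] := choice (fun k => hC_surj (F \o tensor_hom (p k))).
exists (\sum_(k < n) i k (r k)); apply: linear_ext => f /=.
rewrite [in RHS](hom_dual_basis ipP f) !linear_sum; apply: eq_bigr => k _.
have /= <- := linear_congr (rP k) (f (i k 1)).
by rewrite -!linearZ /= -[in LHS](mulr1 (r k)).
Qed.

End Bidual.

Section CoaugmentedComplex.
Variables (R : comNzRingType) (M : lmodType R) (K : nat -> lmodType R).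
Variables (delta : {linear M -> K 0%N}) (dK : forall n, {linear K n -> K n.+1}).

Definition coaug_obj (n : nat) : lmodType R :=
  match n with
  | 0 => M
  | m.+1 => K m
  end.

Definition coaug_d (n : nat) : {linear coaug_obj n -> coaug_obj n.+1} :=
  match n with
  | 0 => delta
  | m.+1 => dK m
  end.

End CoaugmentedComplex.

Section Transpose.
Variables (R : comNzRingType) (M C P0 P1 : lmodType R).
Variables (d1 : {linear P1 -> P0}) (d0 : {linear P0 -> M}).
Hypothesis homothety_inj : injective (homothety C).
Hypothesis homothety_surj : surjective (homothety C).
Hypothesis C_acyclic : acyclic C C.
Hypothesis P0_add : in_add R^o P0.
Hypothesis P1_add : in_add R^o P1.
Hypothesis d0_surj : surjective d0.
Hypothesis d0_exact : exact d1 d0.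
Variable G : resolution (submodule (lkernel (hom_pre C d1))).

Definition tr_obj (n : nat) : lmodType R :=
  match n with
  | 0 => {linear P1 -> C}
  | 1 => {linear P0 -> C}
  | k.+2 => res_obj G k
  end.

Definition tr_d (n : nat) : {linear tr_obj n.+1 -> tr_obj n} :=
  match n with
  | 0 => hom_pre C d1
  | 1 => \val \o res_aug G
  | k.+2 => res_d G k
  end.

Lemma tr_d_exact n : exact (tr_d n.+1) (tr_d n).
Proof.
case: n => [|[|n]] x; last exact: res_exact.
  split=> [/lkernelP Kx|[y <-]]; last exact/lkernelP/(valP (res_aug G y)).
  by have [y yx] := res_aug_surj G (Submodule Kx); exists y; rewrite /= yx.
by rewrite -res_exact0; split=> [x0|/= ->//]; apply: val_inj.
Qed.

Lemma tr_acyclic n : acyclic C (tr_obj n).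
Proof.
case: n => [|[|n]]; try exact/(in_add_acyclic C_acyclic)/hom_in_add.
exact/acyclic_projective/res_projective.
Qed.

Lemma tr_aug_exact : exact (tr_d 0) (quotmod_pi (limage (hom_pre C d1))).
Proof. by move=> x; rewrite quotmod_pi_eq0 limageP. Qed.

Variable delta : {linear M -> {linear res_obj G 0 -> C}}.
Hypothesis deltaE : forall x u, delta (d0 x) u = val (res_aug G u) x.

Definition tr_dual_d :=
  @coaug_d R M (fun n => {linear res_obj G n -> C}) delta (hom_d (res_d G) C).

Lemma tr_dual_complex : is_complex tr_dual_d.
Proof.
case=> [|n] x; last exact/hom_complex/res_chain_complex.
have [y <-] := d0_surj x; apply: linear_ext => u; rewrite /= deltaE.
have -> : res_aug G (res_d G 0 u) = 0 by apply/res_exact0; exists u.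
by [].
Qed.

Lemma tr_dual_cohomology0 :
  isomorphic (cohomology (hom_d tr_d C) 1) (cohomology tr_dual_d 0).
Proof.
have ev0_inj := bidual_eval_inj homothety_inj P0_add.
have [F|ev_inv ev_invK] := factor_inj (f := idfun) ev0_inj.
  exact: bidual_eval_surj.
have ev_invE F (f : {linear P0 -> C}) : f (ev_inv F) = F f.
  exact: (linear_congr (ev_invK F) f).
apply: (subquot_isomorphic (f := d0 \o ev_inv)).
- move=> F /lkernelP/hom_cocycleP F0; apply/lkernelP/linear_ext => u.
  by rewrite /= deltaE ev_invE F0.
- move=> F /hom_boundaryP[F' F'E].
  have [y yP] := bidual_eval_surj homothety_surj P1_add F'.
  apply/eqP/d0_exact; exists y; apply: ev0_inj; rewrite ev_invK.
  by apply: linear_ext => f; rewrite /= F'E -yP.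
- move=> F _ /eqP/d0_exact[y yE]; apply/hom_boundaryP.
  by exists (bidual_eval C P1 y) => f; rewrite -ev_invE -yE.
- move=> m /lkernelP dm; have [x xm] := d0_surj m.
  exists (bidual_eval C P0 x).
    by apply/lkernelP/hom_cocycleP => u; rewrite /= -deltaE xm dm.
  have evK : ev_inv (bidual_eval C P0 x) = x by apply: ev0_inj; rewrite ev_invK.
  by apply/eqP; rewrite /= evK xm subrr.
Qed.

Lemma tr_dual_cohomologyS n :
  isomorphic (cohomology (hom_d tr_d C) n.+2) (cohomology tr_dual_d n.+1).
Proof.
apply: (subquot_isomorphic (f := idfun)) => // [z|z|z zZ]; last first.
- by exists z; rewrite // subrr rpred0.
- case: n z => [|n] z // _ /limageP[m mz]; have [x xm] := d0_surj m.
  apply/hom_boundaryP; exists (bidual_eval C P0 x) => u.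
  by rewrite -[z u]/(idfun z u) -mz -xm; exact: deltaE.
case: n z => [|n] z // /hom_boundaryP[F FE].
have [x xP] := bidual_eval_surj homothety_surj P0_add F.
apply/limageP; exists (d0 x); apply: linear_ext => u.
by rewrite deltaE FE -xP.
Qed.

Lemma Ext_Tr_isomorphic n :
  isomorphic (Ext n.+1 (Tr C d1) C) (cohomology tr_dual_d n).
Proof.
apply: isomorphic_trans (Ext_of_acyclic_resolution _ (quotmod_pi_surj (S := _))
  tr_aug_exact tr_d_exact tr_acyclic n) _.
by case: n => [|n]; [exact: tr_dual_cohomology0|exact: tr_dual_cohomologyS].
Qed.

End Transpose.

Theorem transpose_complex_exists (R : comNzRingType) (M C P0 P1 : lmodType R)
    (d1 : {linear P1 -> P0}) (d0 : {linear P0 -> M}) :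
  noetherian R -> semidualizing C -> fg_proj_presentation d1 d0 ->
  exists (K : nat -> lmodType R) (delta : {linear M -> K 0%N})
         (dK : forall n, {linear K n -> K n.+1}),
    [/\ forall n, in_add C (K n), is_complex (coaug_d delta dK) &
        forall n, isomorphic (Ext n.+1 (Tr C d1) C)
                             (cohomology (coaug_d delta dK) n)].
Proof.
move=> noethR [C_fg [g hK gK] C_ext].
move=> [[P0_fg P0_proj] [P1_fg P1_proj] d0_surj d0_exact].
have P0_add := fg_projective_in_add P0_fg P0_proj.
have P1_add := fg_projective_in_add P1_fg P1_proj.
have hC_surj : surjective (homothety C) by move=> f; exists (g f).
have noethH : noetherian_module {linear P0 -> C}.
  exact/(fg_noetherian noethR)/(in_add_fg C_fg)/hom_in_add.
have [G G_add] := fg_resolution_exists noethR (noethH (lkernel (hom_pre C d1))).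
pose ev x : {linear res_obj G 0 -> C} :=
  bidual_eval C P0 x \o \val \o res_aug G.
have ev_lin : linear ev.
  by move=> a x y; apply: linear_ext => u /=; rewrite linearP.
have [|delta deltaP] := factor_surj (f := mklinear ev_lin) d0_surj.
  move=> x /d0_exact[y <-]; apply: linear_ext => u /=.
  by have /lkernelP/linear_congr/(_ y) := valP (res_aug G u).
have deltaE x u : delta (d0 x) u = val (res_aug G u) x by rewrite deltaP.
exists (fun n => {linear res_obj G n -> C}), delta, (hom_d (res_d G) C); split.
- by move=> n; exact: hom_in_add.
- exact: tr_dual_complex deltaE.
- move=> n; apply: Ext_Tr_isomorphic deltaE n => //; first exact: can_inj hK.
  exact: Ext_zero_acyclic.
Qed.

(** * Ext in the second variable and grade *)

Section Postcomposition.
Variables (R : comNzRingType) (U V V' : lmodType R) (h : {linear V -> V'}).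

Fact hom_post_is_linear :
  linear (fun f : {linear U -> V} => h \o f : {linear U -> V'}).
Proof. by move=> a f g; apply: linear_ext => x; rewrite /= linearP. Qed.
Definition hom_post : {linear {linear U -> V} -> {linear U -> V'}} :=
  mklinear hom_post_is_linear.

End Postcomposition.

Lemma hom_d_post (R : comNzRingType) (X : nat -> lmodType R)
    (D : forall n, {linear X n.+1 -> X n}) (V W : lmodType R)
    (h : {linear V -> W}) n (f : {linear X n -> V}) :
  hom_post _ h (hom_d D V n f) = hom_d D W n (hom_post _ h f).
Proof. exact: linear_ext. Qed.

Lemma ses_hom_post (R : comNzRingType) (P A B D : lmodType R)
    (i : {linear A -> B}) (p : {linear B -> D}) :
  projective P -> ses i p -> ses (hom_post P i) (hom_post P p).
Proof.
move=> Pp [i_inj p_surj exip]; split=> [f g /linear_congr fg|f|f].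
- by apply: linear_ext => x; exact/i_inj/fg.
- have [g gP] := Pp _ _ p f p_surj.
  by exists g; exact: linear_ext.
- split=> [/linear_congr pf|[g <-]]; last first.
    by apply: linear_ext => x; exact: exact_comp0 exip.
  have [x|g gP] := factor_inj (f := f) i_inj; first exact/exip/pf.
  by exists g; exact: linear_ext.
Qed.

Section ExtSecondVariable.
Variables (R : comNzRingType) (X : lmodType R) (G : resolution X).
Implicit Types A B D N U V : lmodType R.

Lemma res_ses_hom_post A B D (i : {linear A -> B}) (p : {linear B -> D}) :
  ses i p ->
  forall n, ses (hom_post (res_obj G n) i) (hom_post (res_obj G n) p).
Proof. by move=> sip n; exact/ses_hom_post/sip/res_projective. Qed.

Lemma Ext_of_ses_boundary A B D (i : {linear A -> B}) (p : {linear B -> D}) n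
    (f : {linear res_obj G n.+1 -> A}) :
  ses i p -> is_zero (Ext_of G D n) ->
  hom_post _ i f \in boundaries (hom_d (res_d G) B) n.+1 ->
  f \in boundaries (hom_d (res_d G) A) n.+1.
Proof.
move=> /res_ses_hom_post sG /Ext_of_is_zeroP D0.
apply: (ses_boundary_reflect sG) D0 => [m g|m g|]; try exact: hom_d_post.
exact/hom_complex/res_chain_complex.
Qed.

Lemma Ext_of_ses_sub A B D (i : {linear A -> B}) (p : {linear B -> D}) n :
  ses i p -> is_zero (Ext_of G D n) -> is_zero (Ext_of G B n.+1) ->
  is_zero (Ext_of G A n.+1).
Proof.
move=> sip D0 /Ext_of_is_zeroP B0; apply/Ext_of_is_zeroP => f df.
apply: Ext_of_ses_boundary sip D0 _; apply: B0.
by rewrite -hom_d_post df linear0.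
Qed.

Lemma Ext_of_ses_quot A B D (i : {linear A -> B}) (p : {linear B -> D}) n :
  ses i p -> is_zero (Ext_of G B n) -> is_zero (Ext_of G A n.+1) ->
  is_zero (Ext_of G D n).
Proof.
move=> /res_ses_hom_post sG /Ext_of_is_zeroP B0 /Ext_of_is_zeroP A0.
apply/Ext_of_is_zeroP.
apply: (ses_exact_at_quot sG) B0 A0 => [m f|m f|]; try exact: hom_d_post.
exact/hom_complex/res_chain_complex.
Qed.

Lemma Ext_of_inj A B (i : {linear A -> B}) :
  injective i -> is_zero (Ext_of G B 0) -> is_zero (Ext_of G A 0).
Proof.
move=> i_inj /Ext_of_is_zeroP B0; apply/Ext_of_is_zeroP => f /hom_cocycleP fd.
have /eqP/linear_congr if0 :
    hom_post _ i f \in boundaries (hom_d (res_d G) B) 0.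
  by apply: B0; apply/hom_cocycleP => y /=; rewrite fd linear0.
by apply/eqP/linear_ext => x; apply: i_inj; rewrite linear0; exact: if0.
Qed.

Lemma Ext_of_in_add U V n :
  in_add U V -> is_zero (Ext_of G U n) -> is_zero (Ext_of G V n).
Proof.
move=> [m [i [p ipP]]] /Ext_of_is_zeroP U0.
apply/Ext_of_is_zeroP => f /hom_cocycleP fd.
have fE : f = \sum_(k < m) hom_post _ (i k) (hom_post _ (p k) f).
  apply: linear_ext => x; rewrite [f x]ipP.
  rewrite -[RHS]/(bidual_eval V (res_obj G n) x
    (\sum_(k < m) hom_post _ (i k) (hom_post _ (p k) f))).
  by rewrite linear_sum.
rewrite fE; apply: rpred_sum => k _.
have: hom_post _ (p k) f \in boundaries (hom_d (res_d G) U) n.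
  by apply: U0; apply/hom_cocycleP => y /=; rewrite fd linear0.
apply: (ses_boundary_image (p := fun l => hom_post _ (i k))) => l g.
exact: hom_d_post.
Qed.

Lemma res_scale_homotopy x n : (forall v : X, x *: v = 0) ->
  exists s : {linear res_obj G n -> res_obj G n.+1},
    forall y, res_d G n (s (res_d G n y)) = x *: res_d G n y.
Proof.
move=> xX; elim: n => [|n [s sP]].
  have [y|s sP] := projective_lift (e := res_d G 0) (f := homothety _ x)
    (@res_projective _ _ G 0); last by exists s => y; rewrite sP.
  by apply/res_exact0; rewrite linearZ /= xX.
have [y|s' s'P] := projective_lift (e := res_d G n.+1)
    (f := homothety _ x \- (s \o res_d G n)) (@res_projective _ _ G n.+1).
  by apply/res_exact; rewrite /= linearB linearZ /= sP subrr.
by exists s' => y; rewrite s'P /= res_chain_complex linear0 subr0.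
Qed.

Lemma scale_boundary x N n (f : {linear res_obj G n -> N}) :
  (forall v : X, x *: v = 0) -> hom_d (res_d G) N n f = 0 ->
  homothety _ x f \in boundaries (hom_d (res_d G) N) n.
Proof.
move=> xX /hom_cocycleP; case: n f => [|n] f fd.
  apply/eqP/linear_ext => y; rewrite -[LHS]/(x *: f y) -linearZ.
  have /res_exact0[w <-] : res_aug G (x *: y) = 0 by rewrite linearZ /= xX.
  exact: fd.
have [s sP] := res_scale_homotopy n xX.
apply/hom_boundaryP; exists (f \o s) => y.
apply/eqP; rewrite -[_ y]/(x *: f y) -linearZ -subr_eq0 -linearB; apply/eqP.
have /res_exact[w <-] : res_d G n (x *: y - s (res_d G n y)) = 0.
  by rewrite linearB sP linearZ subrr.
exact: fd.
Qed.

Definition grade_ge n N : Prop := forall j, (j < n)%N -> is_zero (Ext_of G N j).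

Lemma grade_ge_leq m n N : (m <= n)%N -> grade_ge n N -> grade_ge m N.
Proof. by move=> le_mn gN j lt_jm; apply: gN; exact: leq_trans lt_jm le_mn. Qed.

Lemma grade_ge_in_add n U V : in_add U V -> grade_ge n U -> grade_ge n V.
Proof. by move=> UV gU j lt_jn; exact: Ext_of_in_add UV (gU j lt_jn). Qed.

End ExtSecondVariable.
(** * Regular sequences *)

Section RegularSequences.
Variable S : comNzRingType.
Implicit Types N : lmodType S.

Definition regular_element N (x : S) : Prop :=
  forall n : N, x *: n = 0 -> n = 0.

Definition modx N (x : S) : lmodType S := quotmod (limage (homothety N x)).
Definition modx_pi N (x : S) : {linear N -> modx N x} := quotmod_pi _.

Lemma modx_pi_surj N x : surjective (modx_pi N x).
Proof. exact: quotmod_pi_surj. Qed.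

Lemma modx_pi_eq0 N x n : modx_pi N x n = 0 <-> exists n', x *: n' = n.
Proof. by rewrite quotmod_pi_eq0 limageP. Qed.

Lemma modx_ses N x : regular_element N x -> ses (homothety N x) (modx_pi N x).
Proof.
move=> x_reg; split; [|exact: modx_pi_surj|exact: modx_pi_eq0].
exact/raddf_inj/x_reg.
Qed.

Lemma seq_mul_nil N (n : N) : seq_mul [::] n <-> n = 0.
Proof.
split=> [[c ->]|->]; first by rewrite big_ord0.
by exists (fun=> 0); rewrite big_ord0.
Qed.

Lemma seq_mul_cons N x s (n : N) :
  seq_mul (x :: s) n <-> seq_mul s (modx_pi N x n).
Proof.
split=> [[c ->]|[c cP]].
  exists (fun i => modx_pi N x (c (lift ord0 i))).
  rewrite big_ord_recl linearD linear_sum /=.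
  have -> : modx_pi N x (x *: c ord0) = 0 by apply/modx_pi_eq0; exists (c ord0).
  by rewrite add0r; apply: eq_bigr => i _; rewrite linearZ.
have [c' c'P] := choice (fun i => modx_pi_surj (c i)).
pose m := \sum_(i < size s) s`_i *: c' i.
have /modx_pi_eq0[n' n'P] : modx_pi N x (n - m) = 0.
  rewrite linearB cP linear_sum; apply/eqP; rewrite subr_eq0; apply/eqP.
  by apply: eq_bigr => i _; rewrite linearZ c'P.
exists (fun i => if unlift ord0 i is Some j then c' j else n').
rewrite big_ord_recl unlift_none /= n'P -[LHS](subrK m).
by congr (_ + _); apply: eq_bigr => i _; rewrite liftK.
Qed.

Lemma regular_seq_nil N : ~ is_zero N -> regular_seq N [::].
Proof.
move=> /existsNP[n n0]; split=> //; exists n.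
by move=> /seq_mul_nil.
Qed.

Lemma regular_seq_cons N x s :
  regular_seq N (x :: s) <-> regular_element N x /\ regular_seq (modx N x) s.
Proof.
split=> [[reg [n nP]]|[x_reg [reg [y yP]]]].
  split.
    by move=> n' xn; apply/seq_mul_nil/(reg 0%N) => //; exact/seq_mul_nil.
  split; last by exists (modx_pi N x n) => /seq_mul_cons.
  move=> i lt_i y; have [n' <-] := modx_pi_surj y; rewrite -linearZ => xn'.
  by apply/seq_mul_cons/(reg i.+1) => //; exact/seq_mul_cons.
split; last first.
  by have [n nE] := modx_pi_surj y; exists n => /seq_mul_cons; rewrite nE.
case=> [|i] lt_i n /=; first by move=> /seq_mul_nil/x_reg->; exact/seq_mul_nil.
move=> /seq_mul_cons; rewrite linearZ => xn; apply/seq_mul_cons.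
exact: reg xn.
Qed.

Section Grade.
Variables (X : lmodType S) (G : resolution X).

Lemma grade_ge_modx N x n :
  regular_element N x -> grade_ge G n.+1 N -> grade_ge G n (modx N x).
Proof.
move=> /modx_ses sx gN j lt_jn; apply: Ext_of_ses_quot sx _ _; apply: gN => //.
exact: ltnW.
Qed.

Lemma grade_ge_regular N x n :
  (forall v : X, x *: v = 0) -> regular_element N x ->
  grade_ge G n (modx N x) -> grade_ge G n.+1 N.
Proof.
move=> xX x_reg gNx j lt_jn; apply/Ext_of_is_zeroP => f df.
have xf := scale_boundary xX df; case: j f df xf lt_jn => [|j] f df xf lt_jn.
  move/eqP/linear_congr: xf => xf; apply/eqP/linear_ext => y.
  exact/x_reg/xf.
apply: Ext_of_ses_boundary (modx_ses x_reg) _ _; first exact: gNx.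
by rewrite (_ : hom_post _ _ f = homothety _ x f) //; exact: linear_ext.
Qed.

Lemma regular_seq_grade_ge N s :
  (forall x, x \in s -> forall v : X, x *: v = 0) -> regular_seq N s ->
  grade_ge G (size s) N.
Proof.
elim: s N => [|x s IHs] N sX //= /regular_seq_cons[x_reg reg].
apply: (grade_ge_regular _ x_reg); first by apply: sX; rewrite mem_head.
by apply: IHs => // y ys; apply: sX; rewrite inE ys orbT.
Qed.

End Grade.
End RegularSequences.

(** * Depth over a noetherian local ring *)

Section MaximalAnnihilators.
Variable S : comNzRingType.
Implicit Types N V : lmodType S.

Lemma noetherian_maximal V (F : submod V -> Prop) : noetherian_module V ->
  (exists U, F U) ->
  exists2 U, F U & forall U', F U' -> {subset U <= U'} -> {subset U' <= U}.
Proof.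
move=> noethV [U0 FU0]; apply: contrapT => no_max.
have [U|f [_ fP]] := @dependent_choice {U | F U} (fun U U' =>
  {subset sval U <= sval U'} /\ ~ {subset sval U' <= sval U})
  _ (exist _ U0 FU0).
  apply: cid; apply: contrapT => no_step; apply: no_max.
  exists (sval U); first exact: svalP.
  move=> U' FU' sUU'; apply: contrapT => sU'U; apply: no_step.
  by exists (exist _ U' FU').
have mono i j : (i <= j)%N -> {subset sval (f i) <= sval (f j)}.
  move=> /subnK <-; elim: (j - i)%N => [|k IHk] x // xi.
  by rewrite addSn; apply: (fP _).1; exact: IHk.
have union_closed : submod_closed [pred x | `[< exists n, x \in sval (f n) >]].
  split; first by apply/asboolP; exists 0%N; exact: rpred0.
  move=> a x y /asboolP[i xi] /asboolP[j yj]; apply/asboolP; exists (maxn i j).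
  apply: rpredD; last exact: mono (leq_maxr i j) _ yj.
  exact/rpredZ/(mono _ _ (leq_maxl i j)).
have /fg_submoduleP[k [g [gU gP]]] := noethV (Submod union_closed).
have /choice[h hP] : forall i : 'I_k, exists n, g i \in sval (f n).
  by move=> i; have /asboolP := gU i.
have [_] := fP (\max_i h i); apply => x xf.
have [|c ->] := gP x; first by apply/asboolP; exists (\max_i h i).+1.
apply: rpred_sum => i _; apply: rpredZ.
exact: mono (leq_bigmax i) _ (hP i).
Qed.

Definition span V (s : seq V) : submod V :=
  limage (lincomb (fun i : 'I_(size s) => s`_i)).

Lemma mem_span V (s : seq V) v : v \in s -> v \in span s.
Proof.
rewrite -index_mem => lt_vs; apply/limageP; exists (delta_mx 0 (Ordinal lt_vs)).
rewrite /= (bigD1 (Ordinal lt_vs)) //= big1 => [|i /negPf neq_i].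
  by rewrite mxE !eqxx scale1r addr0 nth_index // -index_mem.
by rewrite mxE neq_i andbF scale0r.
Qed.

Lemma span_subset V (s : seq V) (U : submod V) :
  {subset s <= U} -> {subset span s <= U}.
Proof.
move=> sU _ /limageP[c <-]; apply: rpred_sum => i _; apply/rpredZ/sU.
exact: mem_nth.
Qed.

Fact lscale_is_linear N (n : N) : linear (fun r : S^o => (r : S) *: n).
Proof. by move=> a x y; rewrite scalerDl scalerA. Qed.
Definition lscale N (n : N) : {linear S^o -> N} :=
  mklinear (lscale_is_linear n).

Definition annihilator N (n : N) : submod S^o := lkernel (lscale n).

Lemma annihilatorP N (n : N) a : a \in annihilator n <-> a *: n = 0.
Proof. exact: lkernelP. Qed.

Definition max_annihilator N (n : N) : Prop :=
  n <> 0 /\ forall n' : N, n' <> 0 ->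
    {subset annihilator n <= annihilator n'} ->
    {subset annihilator n' <= annihilator n}.

Lemma max_annihilator_exists N (n : N) : noetherian S -> n <> 0 ->
  exists2 n' : N, max_annihilator n' & {subset annihilator n <= annihilator n'}.
Proof.
move=> noethS n0.
pose F U := exists u : N,
  [/\ u <> 0, {subset annihilator n <= annihilator u} & U = annihilator u].
have [|_ [u [u0 nu ->]] umax] := noetherian_maximal (F := F) noethS.
  by exists (annihilator n), n; split.
exists u => //; split=> // u' u'0 uu'; apply: umax => //.
by exists u'; split=> // a /nu/uu'.
Qed.

Lemma max_annihilator_prime N (n : N) a b : max_annihilator n ->
  a \notin annihilator n -> b \notin annihilator n ->
  a * b \notin annihilator n.
Proof.
move=> [n0 nmax] an bn; apply: contra an => /annihilatorP abn.
apply: (nmax (b *: n)).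
- by move/annihilatorP; exact/negP.
- move=> c /annihilatorP cn; apply/annihilatorP.
  by rewrite scalerA mulrC -scalerA cn scaler0.
- by apply/annihilatorP; rewrite scalerA.
Qed.

Lemma max_annihilator_prod N (n : N) (s : seq N) : max_annihilator n ->
  (forall l, l \in s ->
    exists2 a, a \in annihilator l & a \notin annihilator n) ->
  exists2 a, forall l, l \in s -> a \in annihilator l & a \notin annihilator n.
Proof.
move=> nmax; elim: s => [|l s IHs] sn.
  by exists 1 => //; apply/negP => /annihilatorP; rewrite scale1r; case: nmax.
have [l' l's|a as0 an] := IHs; first by apply: sn; rewrite inE l's orbT.
have [b bl bn] := sn l (mem_head _ _).
exists (a * b); last exact: max_annihilator_prime.
move=> l'; rewrite inE => /predU1P[->|l's]; first exact: rpredZ.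
by rewrite mulrC; apply/(rpredZ (b : S))/as0.
Qed.

Lemma max_annihilator_finite N : noetherian_module N ->
  exists2 s : seq N, forall l, l \in s -> max_annihilator l &
    forall n : N, max_annihilator n ->
      exists2 l, l \in s & {subset annihilator n <= annihilator l}.
Proof.
move=> noethN.
pose F U :=
  exists s : seq N, (forall l, l \in s -> max_annihilator l) /\ U = span s.
have [|_ [s [smax ->]] Umax] := noetherian_maximal (F := F) noethN.
  by exists (span [::]), [::].
exists s => // n nmax; apply: contrapT => no_l.
have ns : n \in span s.
  apply: (Umax (span (n :: s))); last by apply: mem_span; rewrite mem_head.
    by exists (n :: s); split=> // l; rewrite inE => /predU1P[->|/smax].
  by apply: span_subset => l ls; apply: mem_span; rewrite inE ls orbT.
have [l ls|a as0 /negP[]] := @max_annihilator_prod N n s nmax.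
  apply: contrapT => no_a; apply: no_l; exists l => //.
  have [_ lmax] := smax l ls; apply: lmax; first by case: nmax.
  by move=> a al; apply: contrapT => /negP an; apply: no_a; exists a.
apply/annihilatorP/(lkernelP (homothety N a)); apply: span_subset ns => l /as0.
by move/annihilatorP => al; apply/lkernelP.
Qed.

Lemma max_annihilator_prime_avoidance N (s : seq N) (I : submod S^o) :
  (forall l, l \in s -> max_annihilator l) ->
  (forall l, l \in s -> exists2 a, a \in I & a \notin annihilator l) ->
  exists2 a, a \in I & forall l, l \in s -> a \notin annihilator l.
Proof.
elim: s => [|l s IHs] smax sI; first by exists 0 => //; exact: rpred0.
have [l' l's|l' l's|a Ia as0] := IHs.
- by apply: smax; rewrite inE l's orbT.
- by apply: sI; rewrite inE l's orbT.
have [al|al] := boolP (a \in annihilator l); last first.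
  by exists a => // l'; rewrite inE => /predU1P[->|/as0].
have lmax := smax l (mem_head _ _); have [b Ib bl] := sI l (mem_head _ _).
have [l' l's|z zs zl] := @max_annihilator_prod N l s lmax.
  apply: contrapT => no_c; have /negP := as0 l' l's; apply.
  have [_ l'max] : max_annihilator l' by apply: smax; rewrite inE l's orbT.
  apply: (l'max l) al; first by case: lmax.
  by move=> c cl'; apply: contrapT => /negP cl; apply: no_c; exists c.
exists (a + z * b); first exact/rpredD/(rpredZ (z : S)).
move=> l'; rewrite inE => /predU1P[->|l's].
  by rewrite rpredDl //; exact: max_annihilator_prime.
by rewrite rpredDr ?as0 // mulrC; apply/(rpredZ (b : S))/zs.
Qed.

Lemma regular_element_exists N (I : submod S^o) :
  noetherian S -> noetherian_module N ->
  (forall n : N, {subset I <= annihilator n} -> n = 0) ->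
  exists2 a : S, a \in I & regular_element N a.
Proof.
move=> noethS noethN NI; have [s smax sP] := max_annihilator_finite noethN.
have [l ls|a Ia as0] := max_annihilator_prime_avoidance (I := I) smax.
  apply: contrapT => no_a; have [l0 _] := smax l ls; apply/l0/NI => a Ia.
  by apply: contrapT => /negP al; apply: no_a; exists a.
exists a => // n /annihilatorP an; apply: contrapT.
move=> /(max_annihilator_exists noethS)[n' /sP[l ls n'l] nn'].
by have /negP := as0 l ls; apply; exact/n'l/nn'.
Qed.

End MaximalAnnihilators.

Lemma int_sup_geP (A : set int) (n : int) : A !=set0 ->
  (n%:E <= int_sup A)%E <-> exists2 a, A a & n <= a.
Proof.
move=> /int_supP[ub lub]; split=> [le_n|[a Aa le_na]]; last first.
  by apply: le_trans (ub a%:E _); [rewrite lee_fin | exists a].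
apply: contrapT => no_a.
have : (n%:E <= (n - 1)%:E :> \bar int)%E.
  apply: le_trans le_n _; apply: lub => _ [a Aa <-]; rewrite lee_fin.
  have [le_na|] := leP n a; last by lia.
  by case: no_a; exists a.
rewrite lee_fin; lia.
Qed.

Lemma depth_regular_seqP (S : comNzRingType) (N : lmodType S) (I : set S)
    (n : int) :
  ~ is_zero N ->
  (n%:E <= depth N I)%E <->
  exists s : seq S,
    [/\ forall x, x \in s -> I x, regular_seq N s & n <= (size s)%:Z].
Proof.
move=> N0; rewrite /depth; case: asboolP => // _.
rewrite int_sup_geP; last first.
  by exists 0, [::] => //; split=> //; exact: regular_seq_nil.
split=> [[_ [s [sI reg] <-] le_ns]|[s [sI reg le_ns]]]; first by exists s.
by exists (size s)%:Z => //; exists s.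
Qed.

Lemma depth_ge0 (S : comNzRingType) (N : lmodType S) (I : set S) :
  (0 <= depth N I)%E.
Proof.
have [N0|N0] := pselect (is_zero N).
  by rewrite /depth; case: asboolP => // _; exact: leey.
apply/(depth_regular_seqP _ _ N0); exists [::]; split=> //.
exact: regular_seq_nil.
Qed.

Lemma Ext_of0_is_zeroP (R : comNzRingType) (X N : lmodType R)
    (G : resolution X) :
  is_zero (Ext_of G N 0) <-> is_zero {linear X -> N}.
Proof.
rewrite Ext_of_is_zeroP; split=> [N0 h|N0 f /hom_cocycleP fd].
  apply: linear_ext => x; have [y <-] := res_aug_surj G x.
  have /eqP/linear_congr :
      hom_pre N (res_aug G) h \in boundaries (hom_d (res_d G) N) 0.
    apply: N0; apply/hom_cocycleP => w /=.
    have -> : res_aug G (res_d G 0 w) = 0 by apply/res_exact0; exists w.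
    exact: linear0.
  exact.
have [x|h hP] := factor_surj (f := f) (@res_aug_surj _ _ G).
  by move=> /res_exact0[y <-].
by apply/eqP/linear_ext => x; rewrite -hP (N0 h).
Qed.

Lemma hom_quotmod_is_zeroP (S : comNzRingType) (I : submod S^o)
    (N : lmodType S) :
  is_zero {linear quotmod I -> N} <->
  forall n : N, {subset I <= annihilator n} -> n = 0.
Proof.
split=> [hom0 n nI|NI h].
  have [r /quotmod_pi_eq0/nI/annihilatorP //|h hP] :=
    factor_surj (f := lscale n) (@quotmod_pi_surj _ _ I).
  by rewrite -[n]scale1r -[LHS]/(lscale n 1) -hP (hom0 h).
have h1 : h (quotmod_pi I 1) = 0.
  apply: NI => a Ia; apply/annihilatorP; rewrite -!linearZ /=.
  have -> : quotmod_pi I (a *: (1 : S^o)) = 0.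
    by apply/quotmod_pi_eq0; rewrite -[_ *: _]/(a * 1) mulr1.
  exact: linear0.
apply: linear_ext => x; have [r <-] := quotmod_pi_surj x.
by rewrite -[r]mulr1 -[_ * _]/((r : S) *: (1 : S^o)) !linearZ /= h1 scaler0.
Qed.

Section LocalDepth.
Variables (S : comNzRingType) (I : submod S^o).
Implicit Types N : lmodType S.

Definition local_ideal : Prop :=
  1 \notin I /\ forall x : S, x \notin I -> exists y : S, y * x = 1.

Hypothesis noethS : noetherian S.
Hypothesis local_I : local_ideal.

Lemma nakayama N (x : S) : x \in I -> finitely_generated N ->
  surjective (homothety N x) -> is_zero N.
Proof.
have [I1 I_unit] := local_I.
move=> Ix [k [g gP]] xN; elim: k g gP => [|k IHk] g gP n.
  by have [c ->] := gP n; rewrite big_ord0.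
apply: (IHk (g \o lift ord0)) => {}n.
have [n' /= n'E] := xN (g ord0); have [c cE] := gP n'.
have [|v vP] := I_unit (1 - x * c ord0).
  apply: contra I1 => I1xc; rewrite -(subrK (x * c ord0) 1) rpredD //.
  by rewrite mulrC; apply: (rpredZ (c ord0 : S)).
have g0 : g ord0 = \sum_(i < k) (v * x * c (lift ord0 i)) *: g (lift ord0 i).
  have gE : g ord0 - (x * c ord0) *: g ord0 =
      x *: \sum_(i < k) c (lift ord0 i) *: g (lift ord0 i).
    by rewrite -[X in X - _]n'E cE big_ord_recl scalerDr scalerA addrC addKr.
  rewrite -[LHS]scale1r -vP -scalerA scalerBl scale1r gE !scaler_sumr.
  by apply: eq_bigr => i _; rewrite !scalerA mulrA.
have [e ->] := gP n.
exists (fun i => e ord0 * (v * x * c (lift ord0 i)) + e (lift ord0 i)).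
rewrite big_ord_recl [in LHS]g0 scaler_sumr -big_split.
by apply: eq_bigr => i _; rewrite /= scalerA -scalerDl.
Qed.

Variable G : resolution (quotmod I).

Lemma grade_ge_regular_seq N n : finitely_generated N -> ~ is_zero N ->
  grade_ge G n N ->
  exists s : seq S, [/\ size s = n, {subset s <= I} & regular_seq N s].
Proof.
elim: n N => [|n IHn] N fgN N0 NE.
  by exists [::]; split=> //; exact: regular_seq_nil.
have [x Ix x_reg] : exists2 x : S, x \in I & regular_element N x.
  apply: regular_element_exists => //; first exact: fg_noetherian.
  exact/hom_quotmod_is_zeroP/Ext_of0_is_zeroP/NE.
have [||s [sz sI reg]] := IHn (modx N x) _ _ (grade_ge_modx x_reg NE).
- exact: fg_surj (@modx_pi_surj _ N x) fgN.
- move=> Nx0; apply/N0/(nakayama Ix fgN) => m.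
  by apply/modx_pi_eq0; exact: Nx0.
exists (x :: s); split=> [|y|]; first by rewrite /= sz.
  by rewrite inE => /predU1P[->|/sI].
by apply/regular_seq_cons.
Qed.

Lemma quotmod_annihilated (x : S) (v : quotmod I : lmodType S) :
  x \in I -> x *: v = 0.
Proof.
move=> Ix; have [r <-] := quotmod_pi_surj v; rewrite -linearZ.
apply/quotmod_pi_eq0; rewrite -[_ *: _]/(x * r) mulrC.
exact: (rpredZ (r : S)).
Qed.

Lemma depth_geP N n : finitely_generated N ->
  (n%:Z%:E <= depth N [set x | x \in I])%E <-> grade_ge G n N.
Proof.
move=> fgN; have [N0|N0] := pselect (is_zero N).
  rewrite /depth; case: asboolP => // _; split=> [_ j _|_]; last exact: leey.
  apply/Ext_of_is_zeroP => f _; rewrite (_ : f = 0) ?rpred0 //.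
  by apply: linear_ext => x; exact: N0.
rewrite depth_regular_seqP //.
split=> [[s [sI reg le_ns]]|/(grade_ge_regular_seq fgN N0)[s [sz sI reg]]].
  apply: grade_ge_leq le_ns _; apply: regular_seq_grade_ge reg => x /sI Ix v.
  exact: quotmod_annihilated.
by exists s; rewrite sz.
Qed.

End LocalDepth.

(** * Localization at a prime ideal *)

Section Localization.
Variables (R : comNzRingType) (p : prime_idealr R).
Implicit Types U V M E : lmodType R.
Local Notation S := (loc_ring p).

Lemma frac0 M s : frac (0 : M) s = 0 :> localization p M.
Proof. by apply/frac_eqP; exists (den1 p); rewrite !scaler0. Qed.

Lemma frac_eq0 M (m : M) s :
  frac m s = 0 :> localization p M <-> exists w : denominator p, den w *: m = 0.
Proof.
split=> [/frac_eqP[w]|[w wm]]; last first.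
  rewrite -(frac0 M (den1 p)); apply/frac_eqP; exists w.
  by rewrite scaler0 mulrC -scalerA wm scaler0.
by rewrite scaler0 /= mulr1 => wm; exists w.
Qed.

Lemma frac_cancel M (w : denominator p) (m : M) s :
  frac (den w *: m) (denM w s) = frac m s :> localization p M.
Proof.
by apply/frac_eqP; exists (den1 p) => /=; rewrite scalerA; congr (_ *: _); ring.
Qed.

Lemma frac_add M (m n : M) s t :
  frac m s + frac n t = frac (den t *: m + den s *: n) (denM s t)
    :> localization p M.
Proof. exact: loc_add_frac. Qed.

Lemma fracD M (m n : M) s :
  frac (m + n) s = frac m s + frac n s :> localization p M.
Proof. by rewrite frac_add -scalerDr frac_cancel. Qed.

Lemma frac_sum M n (F : 'I_n -> M) s :
  frac (\sum_(i < n) F i) s = \sum_(i < n) frac (F i) s :> localization p M.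
Proof.
by apply: (big_morph (fun m => frac m s : localization p M)) => [? ?|];
  [exact: fracD | exact: frac0].
Qed.

Lemma frac_scale M (r : R) s (m : M) t :
  (frac (r : R^o) s : S) *: frac m t = frac (r *: m) (denM s t)
    :> localization p M.
Proof. exact: loc_scale_frac. Qed.

Lemma frac_scale_den1 M (r : R) (m : M) s :
  (frac (r : R^o) (den1 p) : S) *: frac m s = frac (r *: m) s
    :> localization p M.
Proof.
by rewrite frac_scale; apply/frac_eqP; exists (den1 p); rewrite /= !mul1r.
Qed.

Lemma frac_lincomb M n (c : 'I_n -> R) (g : 'I_n -> M) s :
  frac (\sum_(i < n) c i *: g i) s =
  \sum_(i < n) (frac (c i : R^o) s : S) *: frac (g i) (den1 p)
    :> localization p M.
Proof.
rewrite frac_sum; apply: eq_bigr => i _; rewrite frac_scale.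
by apply/frac_eqP; exists (den1 p); rewrite /= !mulr1.
Qed.

Definition loc_fun U V (f : {linear U -> V}) (x : localization p U) :
  localization p V := frac (f (repr x).1) (repr x).2.

Lemma loc_fun_frac U V (f : {linear U -> V}) u s :
  loc_fun f (frac u s) = frac (f u) s.
Proof.
have [w e] := repr_frac u s; apply/frac_eqP; exists w.
by rewrite -!linearZ e.
Qed.

Fact loc_fun_is_linear U V (f : {linear U -> V}) : linear (loc_fun f).
Proof.
elim/frac_ind=> r s; elim/frac_ind=> u t; elim/frac_ind=> v t'.
rewrite frac_scale frac_add !loc_fun_frac frac_scale frac_add.
rewrite linearD [f (den t' *: _)]linearZ [f (r *: _)]linearZ.
by rewrite [f (den _ *: _)]linearZ.
Qed.
Definition loc_map U V (f : {linear U -> V}) :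
    {linear localization p U -> localization p V} :=
  mklinear (loc_fun_is_linear f).

Lemma loc_map_frac U V (f : {linear U -> V}) u s :
  loc_map f (frac u s) = frac (f u) s.
Proof. exact: loc_fun_frac. Qed.

Lemma loc_map_surj U V (f : {linear U -> V}) :
  surjective f -> surjective (loc_map f).
Proof.
move=> f_surj; elim/frac_ind=> v s; have [u <-] := f_surj v.
by exists (frac u s); rewrite loc_map_frac.
Qed.

Lemma loc_in_add U V :
  in_add U V -> in_add (localization p U) (localization p V).
Proof.
move=> [n [i [q iqP]]].
exists n, (fun k => loc_map (i k)), (fun k => loc_map (q k)).
elim/frac_ind => v s; rewrite [in LHS](iqP v) frac_sum.
by apply: eq_bigr => k _; rewrite (loc_map_frac (q k) v s) loc_map_frac.
Qed.

Lemma loc_fg M : finitely_generated M -> finitely_generated (localization p M).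
Proof.
move=> [n [g gP]]; exists n, (fun i => frac (g i) (den1 p)).
elim/frac_ind => m s; have [c ->] := gP m.
by exists (fun i => frac (c i : R^o) s); rewrite frac_lincomb.
Qed.

Lemma loc_noetherian : noetherian R -> noetherian S.
Proof.
move=> noethR J.
have contraction_closed :
    submod_closed [pred r : R^o | (frac r (den1 p) : S^o) \in J].
  split=> [|a x y]; rewrite !inE ?frac0 ?rpred0 // => Jx Jy.
  rewrite fracD rpredD // -(frac_scale_den1 a (x : R^o) (den1 p)).
  exact: (rpredZ (frac (a : R^o) (den1 p) : S)).
have /fg_submoduleP[n [g [gI gP]]] := noethR (Submod contraction_closed).
apply/fg_submoduleP; exists n, (fun i => frac (g i) (den1 p)); split=> //.
elim/frac_ind=> r s Jr; have [|c cE] := gP r.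
  rewrite inE (_ : frac r (den1 p) =
    (frac (den s : R^o) (den1 p) : S) *: (frac r s : S^o) :> S^o).
    exact: rpredZ.
  rewrite [RHS](frac_scale_den1 (den s) r s).
  by apply/frac_eqP; exists (den1 p); rewrite /= !mul1r scale1r.
exists (fun i => frac (c i : R^o) s); rewrite cE; exact: frac_lincomb.
Qed.

Lemma loc_max_frac (a : R) s :
  loc_max (frac (a : R^o) s : S) <-> a \in (p : {pred R}).
Proof.
split=> [[b [t [pb /frac_eqP[w e]]]]|pa]; last by exists a, s.
have {}e : den w * den t * a = den w * den s * b := e.
have : den w * den t * a \in (p : {pred R}) by rewrite e idealMr.
rewrite prime_idealrM => /orP[|//]; rewrite prime_idealrM.
by rewrite (negPf (valP w)) (negPf (valP t)).
Qed.

Lemma loc_max_closed : submod_closed [pred x : S^o | `[< loc_max (x : S) >]].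
Proof.
split.
  by apply/asboolP; rewrite -(frac0 _ (den1 p)); apply/loc_max_frac/rpred0.
elim/frac_ind=> a s; elim/frac_ind=> x t; elim/frac_ind=> y u.
move=> /asboolP/loc_max_frac px /asboolP/loc_max_frac py; apply/asboolP.
rewrite [X in X + _](frac_scale a s (x : R^o) t) frac_add.
apply/loc_max_frac; rewrite -![_ *: _]/(_ * _).
by rewrite rpredD ?idealMr.
Qed.
Definition loc_ideal : submod S^o := Submod loc_max_closed.

Lemma loc_idealE : @loc_max R p = [set x | x \in loc_ideal].
Proof. by rewrite predeqE => x; split=> /asboolP. Qed.

Lemma frac_loc_ideal (a : R) s :
  (frac (a : R^o) s : S^o) \in loc_ideal <-> a \in (p : {pred R}).
Proof. by rewrite -(loc_max_frac a s); split=> /asboolP. Qed.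

Lemma loc_ideal_local : local_ideal loc_ideal.
Proof.
split=> [|x].
  by apply/negP => /frac_loc_ideal; rewrite (negPf (den1_subproof p)).
elim/frac_ind: x => a s aI.
have pa : (a : R) \notin (p : {pred R}).
  by apply: contra aI => pa; apply/frac_loc_ideal.
exists (frac (den s : R^o) (Denominator pa)).
rewrite [LHS]loc_mul_frac; apply/frac_eqP; exists (den1 p) => /=.
by rewrite -![_ *: _]/(_ * _); ring.
Qed.

Lemma prime_submod_closed : submod_closed [pred a : R^o | a \in (p : {pred R})].
Proof.
split=> [|a x y]; first exact: rpred0.
by rewrite !inE => px py; apply: rpredD => //; exact: idealMr.
Qed.

Lemma prod_den_notin n (w : 'I_n -> denominator p) :
  \prod_(i < n) den (w i) \notin (p : {pred R}).
Proof.
elim/big_ind: _ => [|x y px py|i _]; last exact: (valP (w i)).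
  exact: den1_subproof.
by rewrite prime_idealrM negb_or px py.
Qed.

Lemma is_associated_locP E : noetherian R ->
  is_associated p E <->
  exists2 z : localization p E, z <> 0 & {subset loc_ideal <= annihilator z}.
Proof.
move=> noethR; split=> [[x xP]|[z]].
  exists (frac x (den1 p)).
    by move=> /frac_eq0[w /eqP]; rewrite -xP (negPf (valP w)).
  elim/frac_ind=> a s /frac_loc_ideal; rewrite xP => /eqP ax.
  by apply/annihilatorP; rewrite frac_scale ax frac0.
elim/frac_ind: z => x s x0 xI.
have /fg_submoduleP[n [g [gp gP]]] := noethR (Submod prime_submod_closed).
have /choice[w wP] : forall i : 'I_n, exists w : denominator p,
    den w *: ((g i : R) *: x) = 0.
  move=> i; have /xI/annihilatorP : (frac (g i) (den1 p) : S^o) \in loc_ideal.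
    exact/frac_loc_ideal/(gp i).
  by rewrite (frac_scale_den1 (g i : R)) => /frac_eq0.
pose W := \prod_(i < n) den (w i).
have gW i : (g i : R) *: (W *: x) = 0.
  transitivity
    (\prod_(j < n | j != i) den (w j) *: (den (w i) *: ((g i : R) *: x))).
    by rewrite /W (bigD1 i) //= !scalerA; congr (_ *: _); ring.
  by rewrite wP scaler0.
exists (W *: x) => a; apply/idP/eqP => [/gP[c ->]|aWx].
  rewrite scaler_suml big1 // => i _.
  by rewrite -[LHS]/((c i * g i) *: (W *: x)) -scalerA gW scaler0.
apply: contraT => pa; case: x0; apply/frac_eq0.
have paW : a * W \notin (p : {pred R}).
  by rewrite prime_idealrM negb_or pa prod_den_notin.
by exists (Denominator paW); rewrite -scalerA.
Qed.

Lemma is_associated_homP E : noetherian R ->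
  is_associated p E <->
  ~ is_zero {linear quotmod loc_ideal -> localization p E}.
Proof.
move=> noethR; rewrite is_associated_locP // hom_quotmod_is_zeroP.
split=> [[z z0 zI] no_z|/existsNP[z /not_implyP[zI z0]]]; last by exists z.
exact/z0/no_z.
Qed.

Section LocalizedComplex.
Variables (K : nat -> lmodType R) (dK : forall n, {linear K n -> K n.+1}).

Definition loc_d n : {linear localization p (K n) -> localization p (K n.+1)} :=
  loc_map (dK n).

Lemma loc_complex : is_complex dK -> is_complex loc_d.
Proof.
by move=> cplx n; elim/frac_ind=> x s; rewrite !loc_map_frac cplx frac0.
Qed.

Lemma loc_boundariesP n (m : K n) s :
  frac m s \in boundaries loc_d n <->
  exists w : denominator p, den w *: m \in boundaries dK n.
Proof.
case: n m => [|n] m.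
  split=> [/eqP/frac_eq0[w wm]|[w /eqP wm]]; first by exists w; apply/eqP.
  by apply/eqP/frac_eq0; exists w.
split=> [/limageP[y]|[w /limageP[u uE]]].
  elim/frac_ind: y => u t; rewrite loc_map_frac => /frac_eqP[w e].
  exists (denM w t); apply/limageP; exists ((den w * den s) *: u).
  by rewrite linearZ /= e.
apply/limageP; exists (frac u (denM w s)).
by rewrite loc_map_frac uE frac_cancel.
Qed.

Lemma loc_cohomology n :
  isomorphic (localization p (cohomology dK n)) (cohomology loc_d n).
Proof.
pose Z := lkernel (dK n).
pose v : {linear localization p (submodule Z) -> localization p (K n)} :=
  loc_map \val.
have vE z s : v (frac z s) = frac (val z) s := loc_map_frac _ z s.
have vZ u : v u \in lkernel (loc_d n).
  elim/frac_ind: u => z s; apply/lkernelP; rewrite vE loc_map_frac.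
  have -> : dK n (val z) = 0 by exact/lkernelP/(valP z).
  exact: frac0.
pose q : {linear submodule Z -> cohomology dK n} := quotmod_pi _.
pose q' : {linear submodule (lkernel (loc_d n)) -> cohomology loc_d n} :=
  quotmod_pi _.
apply: (isomorphic_same_kernel (f := loc_map q) (g := q' \o corestrict vZ)).
- exact/loc_map_surj/quotmod_pi_surj.
- move=> y; have [[x Zx] <-] := quotmod_pi_surj y.
  elim/frac_ind: x Zx => m s Zm.
  have /lkernelP := Zm; rewrite loc_map_frac => /frac_eq0[w wm].
  have Zwm : den w *: m \in Z by apply/lkernelP; rewrite linearZ.
  exists (frac (Submodule Zwm) (denM w s)); congr (quotmod_pi _ _).
  by apply: val_inj; rewrite [LHS]vE frac_cancel.
- elim/frac_ind=> z s; rewrite loc_map_frac frac_eq0 quotmod_pi_eq0.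
  rewrite -[_ \in _]/(v (frac z s) \in boundaries loc_d n) vE loc_boundariesP.
  split=> -[w wz]; exists w.
    by move: wz; rewrite -linearZ => /quotmod_pi_eq0.
  by rewrite -linearZ; apply/quotmod_pi_eq0.
Qed.

End LocalizedComplex.
End Localization.

(** * Depth along a complex *)

Lemma isomorphic_in_add (R : comNzRingType) (U V : lmodType R) :
  isomorphic U V -> in_add U V.
Proof.
move=> [f f_inj f_surj]; have [g gK] := factor_inj (f := idfun) f_inj f_surj.
by exists 1%N, (fun=> f), (fun=> g) => v; rewrite big_ord1 gK.
Qed.

Lemma isomorphic_hom (R : comNzRingType) (U V W : lmodType R) :
  isomorphic V W -> isomorphic {linear U -> V} {linear U -> W}.
Proof.
move=> [f f_inj f_surj]; exists (hom_post U f) => [g h /linear_congr fgh|g].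
  by apply: linear_ext => x; exact/f_inj/fgh.
have [x|h hP] := factor_inj (f := g) f_inj; first exact: f_surj.
by exists h; exact: linear_ext.
Qed.

Section Opcycles.
Variables (S : comNzRingType) (L : nat -> lmodType S).
Variable dL : forall n, {linear L n -> L n.+1}.
Hypothesis complexL : is_complex dL.

Definition opcycles (n : nat) : lmodType S := quotmod (boundaries dL n).
Definition opcycles_pi (n : nat) : {linear L n -> opcycles n} := quotmod_pi _.

Lemma opcycles0_isomorphic : isomorphic (opcycles 0) (L 0).
Proof.
apply: isomorphic_sym; exists (opcycles_pi 0); last exact: quotmod_pi_surj.
by apply: raddf_inj => x /quotmod_pi_eq0/eqP.
Qed.

Lemma opcycles_exact n :
  exists (i : {linear cohomology dL n -> opcycles n})
         (d : {linear opcycles n -> L n.+1}),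
    [/\ injective i, exact i d & forall x, d (opcycles_pi n x) = dL n x].
Proof.
have pi_surj : surjective (opcycles_pi n) := @quotmod_pi_surj _ _ _.
have [x /quotmod_pi_eq0|d dE] := factor_surj (f := dL n) pi_surj.
  exact: boundary_cocycle.
pose v : {linear submodule (lkernel (dL n)) -> L n} := \val.
pose q : {linear submodule (lkernel (dL n)) -> cohomology dL n} := quotmod_pi _.
have q_surj : surjective q := @quotmod_pi_surj _ _ _.
have [|i iE] := factor_surj (f := opcycles_pi n \o v) q_surj.
  move=> z /quotmod_pi_eq0 Bz; exact/quotmod_pi_eq0.
exists i, d; split=> //.
  apply: raddf_inj => x; have [z <-] := q_surj x.
  by rewrite /= iE => /quotmod_pi_eq0 Bz; apply/quotmod_pi_eq0.
move=> x; split=> [dx|[y <-]]; last first.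
  by have [z <-] := q_surj y; rewrite iE dE; exact/lkernelP/(valP z).
move: dx; have [y <-] := quotmod_pi_surj x; rewrite dE => /lkernelP Zy.
by exists (q (Submodule Zy)); rewrite iE.
Qed.

Lemma opcycles_ses n : exact_at dL n ->
  exists i : {linear opcycles n -> L n.+1}, ses i (opcycles_pi n.+1).
Proof.
move=> /cohomology_is_zeroP coh0; have [i [d [_ exid dE]]] := opcycles_exact n.
exists d; split; last first.
- move=> x; rewrite quotmod_pi_eq0 limageP; split=> [[y <-]|[y <-]].
    by exists (opcycles_pi n y); rewrite dE.
  by have [z <-] := quotmod_pi_surj y; exists z; rewrite dE.
- exact: quotmod_pi_surj.
by apply: raddf_inj => x /exid[y <-]; rewrite (coh0 y) linear0.
Qed.

Section Grade.
Variables (X : lmodType S) (G : resolution X) (t : nat).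
Hypothesis exactL : forall n, (n < t)%N -> exact_at dL n.

Lemma Ext_of_opcycles0 j :
  is_zero (Ext_of G (opcycles 0) j) <-> is_zero (Ext_of G (L 0) j).
Proof.
have iso := opcycles0_isomorphic.
by split; apply/Ext_of_in_add/isomorphic_in_add => //; exact: isomorphic_sym.
Qed.

Lemma grade_ge_complex :
  (forall n, grade_ge G t (L n.+1)) -> grade_ge G t (L 0).
Proof.
move=> gL j lt_jt; apply/Ext_of_opcycles0.
have : (j + 0 < t)%N by rewrite addn0.
elim: j 0%N lt_jt => [|j IHj] n lt_jt lt_jnt; have [|i si] := @opcycles_ses n.
- exact: exactL.
- by have [i_inj _ _] := si; apply: Ext_of_inj i_inj _; exact: gL.
- by apply: exactL; lia.
by apply: Ext_of_ses_sub si _ (gL n _ lt_jt); apply: IHj; lia.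
Qed.

Lemma Ext_of_complex_top :
  (forall n, grade_ge G t.+1 (L n.+1)) ->
  is_zero (Ext_of G (L 0) t) <-> is_zero {linear X -> cohomology dL t}.
Proof.
move=> gL; rewrite -Ext_of_opcycles0.
have shift k n : (k + n)%N = t ->
    is_zero (Ext_of G (opcycles n) k) <-> is_zero (Ext_of G (opcycles t) 0).
  elim: k n => [|k IHk] n knt; first by rewrite -knt.
  have [|i si] := @opcycles_ses n; first by apply: exactL; lia.
  rewrite -(IHk n.+1); last by lia.
  split=> E0; first by apply: Ext_of_ses_quot si _ E0; apply: gL; lia.
  by apply: Ext_of_ses_sub si E0 _; apply: gL; lia.
rewrite (shift t 0%N) ?addn0 // Ext_of0_is_zeroP.
have [i [d [i_inj exid _]]] := opcycles_exact t.
split=> hom0 h; apply: linear_ext => x.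
  apply: i_inj; rewrite linear0 -[LHS]/(hom_post X i h x).
  by rewrite (hom0 (hom_post X i h)).
have /Ext_of0_is_zeroP homL : is_zero (Ext_of G (L t.+1) 0) by exact: gL.
have [y|g gP] := factor_inj (f := h) i_inj.
  by apply/exid; rewrite -[LHS]/(hom_post X d h y) (homL (hom_post X d h)).
by rewrite -gP (hom0 g) linear0.
Qed.

End Grade.
End Opcycles.

Section DepthComplex.
Variables (R : comNzRingType) (p : prime_idealr R).
Hypothesis noethR : noetherian R.

Let G := std_resolution (quotmod (loc_ideal p)).

Lemma depth_at_geP (M : lmodType R) n : finitely_generated M ->
  (n%:Z%:E <= depth_at p M)%E <-> grade_ge G n (localization p M).
Proof.
move=> fgM; rewrite /depth_at loc_idealE.
apply: depth_geP (loc_fg p fgM); first exact: loc_noetherian.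
exact: loc_ideal_local.
Qed.

Variables (C : lmodType R) (L : nat -> lmodType R).
Variable dL : forall n, {linear L n -> L n.+1}.
Hypothesis C_fg : finitely_generated C.
Hypothesis L0_fg : finitely_generated (L 0).
Hypothesis L_add : forall n, in_add C (L n.+1).
Hypothesis complexL : is_complex dL.

Let grade_ge_loc k n :
  (k%:Z%:E <= depth_at p C)%E -> grade_ge G k (localization p (L n.+1)).
Proof. by move=> /(depth_at_geP _ C_fg); exact/grade_ge_in_add/loc_in_add. Qed.

Let loc_exact_at n : exact_at dL n -> exact_at (loc_d p dL) n.
Proof.
move=> /cohomology_is_zeroP coh0; apply/cohomology_is_zeroP.
apply/(isomorphic_is_zero (loc_cohomology p dL n)).
by elim/frac_ind=> x s; rewrite (coh0 x) frac0.
Qed.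

Lemma depth_complex_ge k :
  (forall n, (n < k)%N -> exact_at dL n) ->
  (k%:Z%:E <= depth_at p C)%E -> (k%:Z%:E <= depth_at p (L 0))%E.
Proof.
move=> exL le_kC; apply/depth_at_geP => //.
apply: (grade_ge_complex (loc_complex complexL)) => [n lt_nk|n].
  exact/loc_exact_at/exL.
exact: grade_ge_loc.
Qed.

Lemma depth_complex_succ_geP t :
  (forall n, (n < t)%N -> exact_at dL n) ->
  (t.+1%:Z%:E <= depth_at p C)%E ->
  (t.+1%:Z%:E <= depth_at p (L 0))%E <-> ~ is_associated p (cohomology dL t).
Proof.
move=> exL le_tC; rewrite is_associated_homP // not_notE.
rewrite (isomorphic_is_zero (isomorphic_hom _ (loc_cohomology p dL t))).
rewrite -(Ext_of_complex_top (G := G) (loc_complex complexL)) => [|n lt_nt|n].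
- rewrite depth_at_geP //; split=> [|E0 j]; first by apply.
  rewrite ltnS leq_eqVlt => /predU1P[->//|]; apply: (depth_at_geP t L0_fg).1.
  apply: depth_complex_ge => //; apply: le_trans le_tC.
  by rewrite lee_fin lez_nat.
- exact/loc_exact_at/exL.
- exact: grade_ge_loc.
Qed.

End DepthComplex.
(** * Torsionfreeness and depth *)

Lemma ereal_int_le_nat (x y : \bar int) : (0 <= y)%E ->
  (forall k : nat, (k%:Z%:E <= x)%E -> (k%:Z%:E <= y)%E) -> (x <= y)%E.
Proof.
case: y => [[m|m]||] // _ xy; last exact: leey.
rewrite leNgt; apply/negP => lt_mx.
have /xy : (m.+1%:Z%:E <= x)%E by case: x lt_mx {xy}.
by rewrite lee_fin lez_nat ltnn.
Qed.

Section TorsionfreeIndex.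
Variables (R : comNzRingType) (C P0 P1 : lmodType R) (d1 : {linear P1 -> P0}).

Lemma torsionfree_leq (i k : int) :
  i <= k -> torsionfree C d1 k -> torsionfree C d1 i.
Proof.
by move=> le_ik tf j j1 le_ji; apply: tf => //; exact: le_trans le_ik.
Qed.

Lemma torsionfree_le0 (i : int) : i <= 0 -> torsionfree C d1 i.
Proof. move=> le_i0 j j1 le_ji; lia. Qed.

Lemma torsionfree_index_natP : (torsionfree_index C d1 < +oo)%E ->
  exists n : nat, torsionfree_index C d1 = n%:Z%:E /\
    forall i : int, torsionfree C d1 i <-> i <= n%:Z.
Proof.
move=> t_fin; have t_ge0 := torsionfree_index_ge0 C d1.
have [n nE] : exists n : nat, torsionfree_index C d1 = n%:Z%:E.
  by case: (torsionfree_index C d1) t_fin t_ge0 => [[n|n]||] //; exists n.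
exists n; split=> // i.
have geP k := int_sup_geP k (ex_intro _ 0 (torsionfree_le0 (lexx 0))).
rewrite -lee_fin -nE; split=> [tfi|/geP[k tfk le_ik]].
  by apply/geP; exists i.
exact: torsionfree_leq tfk.
Qed.

End TorsionfreeIndex.

Section StildeTorsionfree.
Variables (R : comNzRingType) (M C P0 P1 : lmodType R).
Variables (d1 : {linear P1 -> P0}) (d0 : {linear P0 -> M}).
Hypothesis noethR : noetherian R.
Hypothesis M_fg : finitely_generated M.
Hypothesis sdC : semidualizing C.
Hypothesis presM : fg_proj_presentation d1 d0.

Let C_fg : finitely_generated C. Proof. by case: sdC. Qed.

Lemma Stilde_leq (i k : int) : i <= k -> Stilde C M k -> Stilde C M i.
Proof.
move=> le_ik Sk p; apply: le_trans (Sk p).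
by rewrite le_min !ge_min lee_fin le_ik lexx orbT.
Qed.

Lemma torsionfree_depth_ge (p : prime_idealr R) (k : nat) :
  torsionfree C d1 k ->
  (k%:Z%:E <= depth_at p C)%E -> (k%:Z%:E <= depth_at p M)%E.
Proof.
move=> tfk; have [K [delta [dK [K_add cplx iso]]]] :=
  transpose_complex_exists noethR sdC presM.
apply: (depth_complex_ge noethR C_fg M_fg K_add cplx) => n lt_nk.
by apply/cohomology_is_zeroP/(isomorphic_is_zero (iso n))/tfk.
Qed.

Lemma torsionfree_depth_succ_geP (p : prime_idealr R) (t : nat) :
  torsionfree C d1 t -> (t.+1%:Z%:E <= depth_at p C)%E ->
  (t.+1%:Z%:E <= depth_at p M)%E <-> ~ is_associated p (Ext t.+1 (Tr C d1) C).
Proof.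
move=> tft; have [K [delta [dK [K_add cplx iso]]]] :=
  transpose_complex_exists noethR sdC presM.
rewrite (isomorphic_is_associated p (iso t)).
apply: (depth_complex_succ_geP noethR C_fg M_fg K_add cplx) => n lt_nt.
by apply/cohomology_is_zeroP/(isomorphic_is_zero (iso n))/tft.
Qed.

Lemma torsionfree_Stilde (i : int) : torsionfree C d1 i -> Stilde C M i.
Proof.
move=> tfi p; apply: (ereal_int_le_nat (depth_ge0 _ _)) => k.
rewrite le_min lee_fin => /andP[le_ki]; apply: torsionfree_depth_ge.
exact: torsionfree_leq tfi.
Qed.

Lemma Stilde_succP (t : nat) : torsionfree C d1 t ->
  Stilde C M t.+1 <->
  forall p : prime_idealr R, (t.+1%:Z%:E <= depth_at p C)%E ->
    ~ is_associated p (Ext t.+1 (Tr C d1) C).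
Proof.
move=> tft; split=> [St p le_tC|noass p].
  apply/(torsionfree_depth_succ_geP tft le_tC); apply: le_trans (St p).
  by rewrite le_min lexx.
apply: (ereal_int_le_nat (depth_ge0 _ _)) => k.
rewrite le_min lee_fin lez_nat leq_eqVlt => /andP[/predU1P[->|lt_kt] le_C].
  exact/(torsionfree_depth_succ_geP tft le_C)/noass.
by apply: torsionfree_depth_ge le_C; exact: torsionfree_leq tft.
Qed.

End StildeTorsionfree.

Theorem theorem1p1 (R : comNzRingType) (M C P0 P1 : lmodType R)
    (d1 : {linear P1 -> P0}) (d0 : {linear P0 -> M})
    (noethR : noetherian R)
    (fgM : finitely_generated M)
    (sdC : semidualizing C)
    (presM : fg_proj_presentation d1 d0)
    (t_fin : (torsionfree_index C d1 < +oo)%E) :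
  (forall i : int, torsionfree C d1 i <-> Stilde C M i) <->
  (exists p : prime_idealr R,
     is_associated p (Ext (absz (fine (torsionfree_index C d1))).+1 (Tr C d1) C) /\
     (torsionfree_index C d1 + 1 <= depth_at p C)%E).
Proof.
have [n [tE tfP]] := torsionfree_index_natP t_fin.
have SnP := Stilde_succP noethR fgM sdC presM ((tfP n).2 (lexx _)).
rewrite tE (_ : n%:Z%:E + 1 = n.+1%:Z%:E :> \bar int)%E; last first.
  by rewrite -EFinD -addn1 PoszD.
split=> [tf_S|[p [p_ass le_nC]] i].
  have /SnP/existsNP[p] : ~ Stilde C M n.+1.
    by move=> /tf_S/tfP; rewrite lez_nat ltnn.
  by move=> /not_implyP[le_nC /contrapT p_ass]; exists p.
split=> [|Si]; first exact: torsionfree_Stilde noethR fgM sdC presM _.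
apply/tfP; rewrite leNgt; apply/negP => lt_ni.
by apply: (SnP.1 (Stilde_leq _ Si)) le_nC p_ass; lia.
Qed.
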